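(* Let $T>0$, $s>5/2$, and let $f:\mathbb R\to\mathbb R$ be a $C^\infty$ function with $f(0)=0$. Let $u_1,u_2$ be real-valued solutions of the periodic generalized Benjamin-Ono equation $$\partial_tu-\mathcal H\partial_x^2u+\partial_xf(u)=0,\qquad (x,t)\in\mathbb S^1\times[0,T]\simeq\mathbb R/\mathbb Z\times[0,T],$$ such that $$u_1,u_2\in C([0,T]:H^s(\mathbb S^1))\cap C^1((0,T):H^{s-2}(\mathbb S^1)).$$ Suppose there exists an open set $I\subset[-1/2,1/2]$ with $0\in I$ such that $$u_1(x,0)=u_2(x,0)\quad\text{for all }x\in I,$$ and that for each positive integer $N$ there is a constant $c_N$ such that $$\int_{|x|\le R}|\partial_tu_1(x,0)-\partial_tu_2(x,0)|^2\,dx\le c_NR^N\quad\text{as }R\downarrow0$$ (i.e. for all sufficiently small $R>0$). Then $u_1(x,t)=u_2(x,t)$ for all $(x,t)\in\mathbb S^1\times[0,T]$.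
   Context: $\mathbb S^1\simeq\mathbb R/\mathbb Z$ is the circle, with fundamental domain $[-1/2,1/2]$, and $H^s(\mathbb S^1)$ is the usual $L^2$-based periodic Sobolev space. $\mathcal H$ is the periodic Hilbert transform, the Fourier multiplier $\widehat{\mathcal Hg}(n)=-i\,\mathrm{sgn}(n)\,\widehat g(n)$, $n\in\mathbb Z$, with $\mathrm{sgn}(0)=0$. $C([0,T]:X)$ and $C^1((0,T):X)$ denote continuous, respectively continuously differentiable, functions of $t$ with values in the Banach space $X$. The equation holds pointwise, including at $t=0$, where $\partial_tu_j(\cdot,0)$ is the one-sided time derivative, so $\partial_tu_j(\cdot,0)=\mathcal H\partial_x^2u_j(\cdot,0)-\partial_x\big(f(u_j(\cdot,0))\big)$. *)

(* Defs.v *)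
From mathcomp Require Import all_boot all_order all_algebra.
From mathcomp Require Import complex.
From mathcomp Require Import all_classical all_reals all_analysis.

Set Implicit Arguments.
Unset Strict Implicit.
Unset Printing Implicit Defensive.

Import Order.TTheory GRing.Theory Num.Theory.
Import numFieldNormedType.Exports.

Local Open Scope classical_set_scope.
Local Open Scope ring_scope.

(* Functions on the circle R/Z are 1-periodic functions R -> R; integrals over
   the circle are integrals over the fundamental domain [-1/2, 1/2]. A function
   of space and time is a curve u : R -> R -> R, with u t x for u(x,t). *)

Definition circle_dom (R : realType) : set R := `[- 2^-1, 2^-1].

Definition circle_L2 (R : realType) (g : R -> R) : Prop :=
  [/\ periodic g 1,
      measurable_fun setT g &
      (@lebesgue_measure R).-integrable (@circle_dom R)
        (fun x => (g x ^+ 2)%:E)].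

(* The integral of g(x) e^{-2 pi i n x}. *)
Definition fourier_coef (R : realType) (g : R -> R) (n : int) : R[i] :=
  Complex
    (\int[@lebesgue_measure R]_(x in @circle_dom R)
       (g x * cos (2 * pi * n%:~R * x)))%R
    (- (\int[@lebesgue_measure R]_(x in @circle_dom R)
       (g x * sin (2 * pi * n%:~R * x)))%R).

Definition sobolev_norm (R : realType) (r : R) (g : R -> R) : \bar R :=
  ((\esum_(n in [set: int])
     ((1 + n%:~R ^+ 2) `^ r * ComplexField.Normc.normc (fourier_coef g n) ^+ 2)%:E)
   `^ 2^-1)%E.

(* H^r of the circle. Only used for r >= 0, where H^r is a subspace of L^2;
   its elements are represented by functions, defined up to a.e. equality. *)
Definition in_sobolev (R : realType) (r : R) (g : R -> R) : Prop :=
  circle_L2 g /\ (sobolev_norm r g < +oo)%E.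

(* C(D : H^r) *)
Definition C_sobolev (R : realType) (D : set R) (r : R) (u : R -> R -> R) :
    Prop :=
  forall t0, D t0 ->
    in_sobolev r (u t0) /\
    sobolev_norm r (u t \- u t0) @[t --> within D (nbhs t0)] --> 0%E.

(* C^1(D : H^r), for D open *)
Definition C1_sobolev (R : realType) (D : set R) (r : R) (u : R -> R -> R) :
    Prop :=
  (forall t, D t -> in_sobolev r (u t)) /\
  exists2 v : R -> R -> R, C_sobolev D r v &
    forall t, D t ->
      sobolev_norm r (fun x => h^-1 * (u (t + h) x - u t x) - v t x)
        @[h --> 0^'] --> 0%E.

(* h is the Fourier multiplier -i sgn(n) applied to g; this determines h up to
   a.e. equality. *)
Definition is_hilbert_transform (R : realType) (g h : R -> R) : Prop :=
  [/\ circle_L2 g, circle_L2 h &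
      forall n : int,
        fourier_coef h n = - 'i%C * (sgz n)%:~R * fourier_coef g n].

(* Difference quotients with t + h restricted to [0, T]: the limit is the usual
   derivative for 0 < t < T and the one-sided derivative at t = 0 and t = T. *)
Definition dt_quotient (R : realType) (T : R) (u : R -> R -> R) (t x : R) :=
  (h^-1 * (u (t + h) x - u t x)
     @[h --> within [set h | `[0, T]%classic (t + h)] (0 : R)^']).

Definition dt (R : realType) (T : R) (u : R -> R -> R) (t x : R) : R :=
  lim (dt_quotient T u t x).

Definition smooth (R : realType) (f : R -> R) : Prop :=
  forall (n : nat) (x : R), derivable (f^`(n))%classic x 1.

(* Real solutions of  u_t - H u_xx + (f(u))_x = 0  on the circle times [0, T].
   Since s > 5/2, u t is C^2 in x and H u_xx, which lies in H^(s-2), is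
   continuous; continuity of u t and of w selects these representatives, for
   which the equation makes sense pointwise. *)
Definition gBO_solution (R : realType) (T s : R) (f : R -> R)
    (u : R -> R -> R) : Prop :=
  [/\ C_sobolev `[0, T] s u,
      C1_sobolev `]0, T[ (s - 2) u,
      forall t : R, `[0, T]%classic t -> continuous (u t) &
      forall t : R, `[0, T]%classic t ->
        exists w : R -> R,
          [/\ continuous w,
              is_hilbert_transform ((u t)^`(2))%classic w &
              forall x : R,
                cvg (dt_quotient T u t x) /\
                dt T u t x - w x + (f \o u t)^`()%classic x = 0]].

(* Main.v *)
Require Import Defs.
From mathcomp Require Import all_boot all_order all_algebra.
From mathcomp Require Import complex ring lra zify.
From mathcomp Require Import all_classical all_reals all_analysis.
From mathcomp Require Import measurable_realfun.

Import Order.TTheory GRing.Theory Num.Theory.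
Import numFieldNormedType.Exports.

Local Open Scope classical_set_scope.
Local Open Scope ring_scope.

Set Implicit Arguments.
Unset Strict Implicit.
Unset Printing Implicit Defensive.

(** At time 0 let g be the second space derivative of u1 - u2. It vanishes near 0, and so
    does the difference of the nonlinear terms; hence the hypothesis on the time derivatives
    says that the Hilbert transform h of g vanishes to infinite order at 0. For x near 0,
    h(x) is the integral of g(y) cot(pi (x - y)), and with tau = tan(pi x) and
    c = cot(pi y) the kernel is -(c + tau) / (1 - tau c). Its expansion in powers of tau
    shows that all moments of g (1 + c^2) against powers of c vanish. As c is injective on
    the circle minus 0, polynomials in c that peak where g has a sign force g = 0, and
    u1 - u2, which is periodic and vanishes near 0, is 0 at time 0.

    For later times, the integral of (u1 - u2)^2 satisfies a Gronwall inequality, because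
    the dispersive term is skew-adjoint and u1, u2 are bounded in C^1 on [0, T]. The Sobolev
    hypotheses are used only through absolutely convergent Fourier series. *)

(** The Hilbert transform is nonlocal, so the vanishing of g near 0 does not make h vanish there. It
    keeps y away from the pole of the kernel, so for x near 0 no principal value occurs. In the
    coordinates tau and c the kernel is rational and equals -c - tau (1 + c^2) / (1 - tau c): a
    geometric series with an exact remainder, which is where the weight 1 + c^2 comes from. The
    flatness hypothesis is only an integral bound, so it is used to refute every lower bound m |x|^k
    <= |h(x)| near 0; the first nonzero moment would produce such a bound. One peaking argument
    serves twice: with trigonometric polynomials it shows that Fourier coefficients determine a
    continuous function, and with polynomials in c it shows that the moments determine g. *)

Section continuity.
Variable R : realType.
Implicit Types f g : R -> R.

Lemma contD f g : continuous f -> continuous g -> continuous (fun x => f x + g x).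
Proof. by move=> cf cg x; apply: cvgD; [exact: cf|exact: cg]. Qed.

Lemma contN f : continuous f -> continuous (fun x => - f x).
Proof. by move=> cf x; apply: cvgN; exact: cf. Qed.

Lemma contM f g : continuous f -> continuous g -> continuous (fun x => f x * g x).
Proof. by move=> cf cg x; apply: cvgM; [exact: cf|exact: cg]. Qed.

Lemma cont_cst (a : R) : continuous (fun _ : R => a).
Proof. by move=> x; exact: cvg_cst. Qed.

Lemma contX f n : continuous f -> continuous (fun x => f x ^+ n).
Proof.
elim: n => [|n ih] cf.
  by under eq_fun do rewrite expr0; exact: cont_cst.
by under eq_fun do rewrite exprS; apply: contM => //; exact: ih.
Qed.

Lemma cont_id : continuous (fun x : R => x).
Proof. by move=> x; exact: cvg_id. Qed.

Lemma cont_comp f g : continuous f -> continuous g -> continuous (fun x => f (g x)).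
Proof. by move=> cf cg x; apply: (continuous_comp (cg x)); exact: cf. Qed.

Lemma cont_cos f : continuous f -> continuous (fun x => cos (f x)).
Proof. exact/cont_comp/continuous_cos. Qed.

Lemma cont_sin f : continuous f -> continuous (fun x => sin (f x)).
Proof. exact/cont_comp/continuous_sin. Qed.

Lemma cont_norm f : continuous f -> continuous (fun x => `|f x|).
Proof. by move=> cf; apply: (cont_comp _ cf); exact: norm_continuous. Qed.

Lemma cont_sum n (F : nat -> R -> R) : (forall i, continuous (F i)) ->
  continuous (fun x => \sum_(i < n) F i x).
Proof.
move=> cF; elim: n => [|n ih].
  by under eq_fun do rewrite big_ord0; exact: cont_cst.
by under eq_fun do rewrite big_ord_recr; exact: contD.
Qed.

End continuity.

Ltac cont := repeat first
  [ assumption | simple apply cont_cst | simple apply cont_id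
  | simple apply contD | simple apply contN | simple apply contM
  | simple apply contX | simple apply cont_cos | simple apply cont_sin
  | simple apply cont_norm
  | match goal with
    | H : continuous ?f |- continuous (fun x => ?f (@?g x)) =>
        simple apply (@cont_comp _ f g H)
    end ].

(** * Integration of continuous functions over the circle *)

Section circle_integral.
Variable R : realType.
Implicit Types (f g F : R -> R).

Local Notation mu := (@lebesgue_measure R).
Local Notation D := (@circle_dom R).

Definition cint f : R := (\int[mu]_(x in D) f x)%R.

Lemma circle_integrable f : continuous f -> mu.-integrable D (EFin \o f).
Proof.
move=> cf; apply: continuous_compact_integrable; first exact: segment_compact.
exact: continuous_subspaceT.
Qed.

Lemma circle_measurable : measurable D.
Proof. exact: measurable_itv. Qed.

Hint Resolve circle_measurable : core.

Lemma circle_measure : mu D = 1%E.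
Proof.
rewrite /circle_dom lebesgue_measure_itv/= lte_fin ifT; last by lra.
by rewrite -EFinD; congr EFin; lra.
Qed.

Lemma eq_cint f g : f =1 g -> cint f = cint g.
Proof. by move=> fg; apply: eq_Rintegral => x _. Qed.

Lemma cintD f g : continuous f -> continuous g ->
  cint (fun x => f x + g x) = cint f + cint g.
Proof. by move=> cf cg; rewrite /cint RintegralD//; exact: circle_integrable. Qed.

Lemma cintB f g : continuous f -> continuous g ->
  cint (fun x => f x - g x) = cint f - cint g.
Proof. by move=> cf cg; rewrite /cint RintegralB//; exact: circle_integrable. Qed.

Lemma cintZ a f : continuous f -> cint (fun x => a * f x) = a * cint f.
Proof. by move=> cf; rewrite /cint RintegralZl//; exact: circle_integrable. Qed.

Lemma cint_cst a : cint (fun=> a) = a.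
Proof.
rewrite /cint Rintegral_cst// -[RHS]mulr1; congr (_ * _).
exact: (congr1 fine circle_measure).
Qed.

Lemma cint_sum n (F : nat -> R -> R) : (forall i, continuous (F i)) ->
  cint (fun x => \sum_(i < n) F i x) = \sum_(i < n) cint (F i).
Proof.
move=> cF; elim: n => [|n ih].
  by rewrite big_ord0 -[RHS](cint_cst 0); apply: eq_cint => x; rewrite big_ord0.
rewrite big_ord_recr/= -ih -cintD//; last exact: cont_sum.
by apply: eq_cint => x; rewrite big_ord_recr.
Qed.

Lemma le_cint f g : continuous f -> continuous g ->
  (forall x, D x -> f x <= g x) -> cint f <= cint g.
Proof. by move=> cf cg fg; apply: le_Rintegral => //; exact: circle_integrable. Qed.

Lemma cint_norm_le M f : continuous f -> (forall x, D x -> `|f x| <= M) ->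
  `|cint f| <= M.
Proof.
move=> cf fM; rewrite ler_norml; apply/andP; split.
  rewrite -[X in X <= _]cint_cst; apply: le_cint => [||x Dx]; cont.
  by move: (fM x Dx); rewrite ler_norml => /andP[].
rewrite -[X in _ <= X]cint_cst; apply: le_cint => [||x Dx]; cont.
by move: (fM x Dx); rewrite ler_norml => /andP[].
Qed.

Lemma cint_derive F f : (forall x : R, is_derive x (1 : R) F (f x)) -> continuous f ->
  cint f = F 2^-1 - F (- 2^-1).
Proof.
move=> dF cf; have cF : continuous F.
  move=> x; apply: differentiable_continuous; apply/derivable1_diffP.
  by case: (dF x).
rewrite /cint /Rintegral (@continuous_FTC2 _ f F)//.
- by lra.
- exact: continuous_subspaceT.
- split; first by move=> x _; case: (dF x).
  + exact/cvg_at_right_filter/cF.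
  + exact/cvg_at_left_filter/cF.
- by move=> x _; rewrite derive1E; case: (dF x).
Qed.

Lemma cint_derive_periodic F f : periodic F 1 ->
  (forall x : R, is_derive x (1 : R) F (f x)) -> continuous f -> cint f = 0.
Proof.
move=> pF dF cf; rewrite (cint_derive dF cf) -(pF (- 2^-1)).
by rewrite (_ : - 2^-1 + 1 = 2^-1 :> R) ?subrr//; lra.
Qed.

(** The circle has measure 1, so adding [C] makes the integrand nonnegative at the price of [C]; its
    integral is then at least the part over [a, b]. *)
Lemma cint_lower f a b c C : continuous f -> a <= b ->
  (forall x, a <= x <= b -> D x) ->
  (forall x, a <= x <= b -> c <= f x) -> (forall x, D x -> - C <= f x) ->
  (c + C) * (b - a) - C <= cint f.
Proof.
move=> cf ab abD fc fC.
rewrite lerBlDr -[X in _ <= _ + X]cint_cst -cintD//; last exact: cont_cst.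
have sub : `[a, b]%classic `<=` D.
  by move=> x /=; rewrite in_itv/= => /abD.
have cfC : continuous (fun x => f x + C) by cont.
have iD := circle_integrable cfC.
have iab : mu.-integrable `[a, b]%classic (EFin \o (fun x => f x + C)).
  exact: integrableS iD.
apply: (@le_trans _ _ (\int[mu]_(x in `[a, b]%classic) (f x + C))%R).
  rewrite [X in X <= _](_ : _ = (\int[mu]_(x in `[a, b]%classic) (c + C))%R); last first.
    have E : mu `[a, b]%classic = (b - a)%:E.
      rewrite lebesgue_measure_itv/= lte_fin; case: ifPn => //=.
      by rewrite -leNgt => ba; rewrite (_ : a = b) ?subrr//; apply/le_anti/andP.
    by rewrite Rintegral_cst//; congr (_ * _); exact: (esym (congr1 fine E)).
  apply: le_Rintegral => //=.
    exact: integrableS (circle_integrable (@cont_cst R (c + C))).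
  by move=> x; rewrite in_itv/= => /fc; lra.
rewrite /cint /Rintegral; apply: fine_le.
- exact: integrable_fin_num.
- exact: integrable_fin_num.
- apply: ge0_subset_integral => //.
  + by case/integrableP : iD.
  + by move=> x /fC; rewrite lee_fin; lra.
Qed.

(** The interval lies on one side of [x0], towards 0, because [x0] may be an endpoint of the
    fundamental domain. *)
Lemma circle_subitv (x0 : R) (P : R -> Prop) : D x0 ->
  (\forall x \near x0, P x) ->
  exists a b, [/\ a < b, forall x, a <= x <= b -> D x &
     forall x, a <= x <= b -> P x].
Proof.
rewrite /circle_dom/= in_itv/= => /andP[x1 x2] /nbhs_ballP[e /= e0 eP].
pose d : R := Num.min (e / 2) (1 / 2).
have d0 : 0 < d by rewrite lt_min; apply/andP; split; lra.
have de : d < e by rewrite gt_min; apply/orP; left; lra.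
have d1 : d <= 1 / 2 by rewrite ge_min lexx orbT.
have [x00|x00] := lerP x0 0.
  exists x0, (x0 + d); split; first by lra.
    by move=> x /andP[? ?]; rewrite in_itv/=; apply/andP; split; lra.
  move=> x /andP[? ?]; apply: eP; rewrite /ball/= distrC ger0_norm; lra.
exists (x0 - d), x0; split; first by lra.
  by move=> x /andP[? ?]; rewrite in_itv/=; apply/andP; split; lra.
move=> x /andP[? ?]; apply: eP; rewrite /ball/= ger0_norm; lra.
Qed.

Lemma cint_eq0 f : continuous f -> (forall x, D x -> 0 <= f x) -> cint f = 0 ->
  forall x, D x -> f x = 0.
Proof.
move=> cf f0 If x0 Dx0; apply/eqP; rewrite eq_le f0// andbT leNgt; apply/negP => fx0.
have : \forall x \near x0, f x0 / 2 <= f x.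
  by apply: (cvgr_ge _ (cf x0)); lra.
move=> /(circle_subitv Dx0)[a [b [ab abD abf]]].
have := cint_lower cf (ltW ab) abD abf (C := 0).
rewrite If oppr0 !addr0 => /(_ f0); apply/negP; rewrite -ltNge.
by apply: mulr_gt0; lra.
Qed.

End circle_integral.
#[export] Hint Resolve circle_measurable : core.

(** * Peaking functions and uniqueness of Fourier coefficients *)

Section uniqueness.
Variable R : realType.
Implicit Types (f g h t : R -> R).

Local Notation D := (@circle_dom R).

Lemma circle_bounded f : continuous f -> exists2 M, 0 <= M & forall x, D x -> `|f x| <= M.
Proof.
move=> cf; have [c cD cmax] : exists2 c, c \in `[(- 2^-1)%R, 2^-1%R]%R &
    forall x, x \in `[(- 2^-1)%R, 2^-1%R]%R -> `|f x| <= `|f c|.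
  apply: (@EVT_max R (fun x => `|f x|)); first by lra.
  by apply: continuous_subspaceT => x; exact: (cont_norm cf).
by exists `|f c|.
Qed.

Lemma bernoulli_ge (e : R) n : 0 <= e -> 1 + n%:R * e <= (1 + e) ^+ n.
Proof.
move=> e0; elim: n => [|n ih]; first by rewrite mul0r addr0 expr0.
rewrite exprS; apply: (@le_trans _ _ ((1 + e) * (1 + n%:R * e))).
  have : 0 <= (n%:R : R) by [].
  rewrite -natr1; nra.
by rewrite ler_pM2l//; lra.
Qed.

(* The powers of [t] concentrate where [t > 1], hence where [phi >= 0]. *)
Lemma cint_peak (phi t : R -> R) x0 : continuous phi -> continuous t -> D x0 ->
  1 < t x0 -> 0 < phi x0 ->
  (forall x, D x -> `|t x| <= 1 \/ 0 <= t x /\ 0 <= phi x) ->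
  ~ (forall n, cint (fun x => phi x * t x ^+ n) = 0).
Proof.
move=> cphi ct Dx0 tx0 px0 Hpt H0.
have [M M0 phiM] := circle_bounded cphi.
pose e := (t x0 - 1) / 2; have e0 : 0 < e by rewrite /e; lra.
pose d := phi x0 / 2; have d0 : 0 < d by rewrite /d; lra.
have near1 : \forall x \near x0, d <= phi x by apply: (cvgr_ge _ (cphi x0)); rewrite /d; lra.
have near2 : \forall x \near x0, 1 + e <= t x by apply: (cvgr_ge _ (ct x0)); rewrite /e; lra.
have [a [b [ab abD abP]]] := circle_subitv Dx0 (filterI near1 near2).
(* Bernoulli bounds the integral over [a, b] below by d (b - a) (1 + N e), which exceeds [M] once N
   K > M; the rest of the circle contributes at least -[M]. *)
pose K := d * e * (b - a).
have K0 : 0 < K by rewrite !mulr_gt0//; lra.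
have [N MN] : exists N : nat, M < N%:R * K.
  exists (Num.truncn (M / K)).+1; rewrite -ltr_pdivrMr//.
  by apply: Num.Theory.truncnS_gt.
have cpt : continuous (fun x => phi x * t x ^+ N) by cont.
have := @cint_lower R _ a b (d * (1 + e) ^+ N) M cpt (ltW ab) abD.
rewrite H0.
have P1 x : a <= x <= b -> d * (1 + e) ^+ N <= phi x * t x ^+ N.
  move=> /abP[p1 p2]; apply: ler_pM => //; first exact: ltW.
    by apply: exprn_ge0; lra.
  by rewrite lerXn2r// nnegrE; lra.
have P2 x : D x -> - M <= phi x * t x ^+ N.
  move=> Dx; have [t1|[t0 p0]] := Hpt x Dx; last first.
    by apply: (@le_trans _ _ 0); [lra|apply: mulr_ge0 => //; apply: exprn_ge0].
  suff : `|phi x * t x ^+ N| <= M by rewrite ler_norml => /andP[].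
  rewrite normrM normrX -[M]mulr1; apply: ler_pM => //; first exact: phiM.
  exact: exprn_ile1.
move=> /(_ P1 P2); apply/negP; rewrite -ltNge.
have := bernoulli_ge N (ltW e0).
set X := (1 + e) ^+ N => HX.
have : d * (b - a) * (1 + N%:R * e) <= d * (b - a) * X.
  by rewrite ler_wpM2l// mulr_ge0//; lra.
have : 0 < d * (b - a) by apply: mulr_gt0; lra.
have : 0 <= M * (b - a) by apply: mulr_ge0; lra.
move: MN; rewrite /K; lra.
Qed.

Lemma periodic_int g : periodic g 1 -> forall (k : int) x, g (x + k%:~R) = g x.
Proof.
move=> pg [] n x; first exact: (periodicn pg n x).
rewrite NegzE mulrNz -[in RHS](subrK n.+1%:R x) -pmulrn.
exact: (esym (periodicn pg n.+1 (x - n.+1%:R))).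
Qed.

Lemma circle_representative x : exists k : int, D (x + k%:~R).
Proof.
exists (- Num.floor (x + 2^-1)); rewrite /circle_dom/= in_itv/= mulrNz.
have := Num.Theory.floor_itv (x + 2^-1); rewrite intrD.
by move=> /andP[]; lra.
Qed.

Lemma periodic_eq0 g : periodic g 1 -> (forall x, D x -> g x = 0) -> forall x, g x = 0.
Proof.
move=> pg g0 x; have [k Dk] := circle_representative x.
by rewrite -(periodic_int pg k) g0.
Qed.

Lemma cos2pi_int (k : int) (x : R) : cos (2 * pi * (x + k%:~R)) = cos (2 * pi * x).
Proof.
pose F (y : R) := cos (2 * pi * y).
have pF : periodic F 1.
  move=> y; rewrite /F mulrDr mulr1 (mulr_natl pi 2).
  exact: cosD2pi.
exact: (periodic_int pF).
Qed.

(** Superlevel sets of the cosine are neighbourhoods of [x0] modulo 1, since cos decreases on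
    [0, pi]. They are the form in which peaking polynomials can see closeness to [x0]. *)
Lemma periodic_pos_near g x0 : continuous g -> periodic g 1 -> 0 < g x0 ->
  exists2 eta, -1 <= eta < 1 & forall x, eta < cos (2 * pi * (x - x0)) -> 0 < g x.
Proof.
move=> cg pg gx0.
have : \forall x \near x0, 0 < g x by apply: (cvgr_gt (g x0) (cg x0)).
move=> /nbhs_ballP[e /= e0 eP].
pose d : R := Num.min e (1 / 2).
have d0 : 0 < d by rewrite lt_min; apply/andP; split; lra.
have de : d <= e by rewrite ge_min lexx.
have d1 : d <= 1 / 2 by rewrite ge_min lexx orbT.
have pi0 := @pi_gt0 R.
have ipi (y : R) : 0 <= y -> y <= 2^-1 -> 2 * pi * y \in `[0, pi]%R.
  move=> y0 y1; rewrite in_itv/=; have : 0 <= pi * y by apply: mulr_ge0 => //; lra.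
  have : 0 <= pi * (2^-1 - y) by apply: mulr_ge0 => //; lra.
  by move=> *; apply/andP; split; lra.
exists (cos (2 * pi * d)).
  rewrite cos_geN1/= -[X in _ < X](@cos0 R) ltr_cos; first by rewrite !mulr_gt0.
    by rewrite in_itv/= lexx; lra.
  by apply: ipi; lra.
have lepi (y : R) : 2 * pi * y < 2 * pi * d -> y < d by rewrite ltr_pM2l// mulr_gt0//.
move=> x; have [k] := circle_representative (x - x0).
rewrite -(cos2pi_int k (x - x0)); set y := x - x0 + _ => Dy.
rewrite -(periodic_int pg k); move: Dy; rewrite /circle_dom/= in_itv/= => /andP[y1 y2] H.
apply: eP; rewrite /ball/= (_ : x0 - (x + k%:~R) = - y); last by rewrite /y; lra.
rewrite normrN; apply: lt_le_trans de.
have [y0|y0] := leP 0 y.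
  by rewrite ger0_norm//; move: H; rewrite ltr_cos; [exact: lepi|apply: ipi; lra|apply: ipi; lra].
by rewrite ltr0_norm//; move: H; rewrite -(cosN (2 * pi * y)) -mulrN ltr_cos; [exact: lepi|apply: ipi; lra|apply: ipi; lra].
Qed.

Lemma circle_integral_trig_eq0 g : continuous g -> periodic g 1 ->
  (forall n : nat, cint (fun x => g x * cos (2 * pi * n%:R * x)) = 0) ->
  (forall n : nat, cint (fun x => g x * sin (2 * pi * n%:R * x)) = 0) ->
  forall x, g x = 0.
Proof.
move=> cg pg gc gs.
(* The free phase [th] covers sines as well as cosines and absorbs the shift by [x0]; integer
   frequencies are needed because z - 1 can be negative. *)
pose Z h := continuous h /\
  forall (z : int) (th : R), cint (fun x => g x * h x * cos (2 * pi * z%:~R * x + th)) = 0.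
have gcz (z : int) : cint (fun x => g x * cos (2 * pi * z%:~R * x)) = 0.
  case: z => n; first exact: gc.
  rewrite -[RHS](gc n.+1); apply: eq_cint => x.
  by rewrite NegzE mulrNz !(mulrN, mulNr) cosN -pmulrn.
have gsz (z : int) : cint (fun x => g x * sin (2 * pi * z%:~R * x)) = 0.
  case: z => n; first exact: gs.
  rewrite -[RHS](mulr0 (-1)) -[in RHS](gs n.+1) -(cintZ (-1)); last by cont.
  apply: eq_cint => x.
  by rewrite NegzE mulrNz !(mulrN, mulNr) sinN -pmulrn mulrN mul1r.
have Z1 : Z (fun=> 1).
  split; first by cont.
  move=> z th.
  transitivity (cint (fun x => cos th * (g x * cos (2 * pi * z%:~R * x))
     - sin th * (g x * sin (2 * pi * z%:~R * x)))).
    by apply: eq_cint => x; rewrite cosD; ring.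
  rewrite cintB; [|by cont|by cont].
  by rewrite cintZ ?gcz; [rewrite cintZ ?gsz; [ring|cont]|cont].
(* Product to sum: a factor cos(2 pi (x - x0)) only moves the frequency by 1 and the phase by 2 pi
   x0. *)
have ZS h (al x0 : R) : Z h -> Z (fun x => h x * (al + cos (2 * pi * (x - x0)))).
  move=> [ch Zh]; split; first by cont.
  move=> z th.
  transitivity (cint (fun x => al * (g x * h x * cos (2 * pi * z%:~R * x + th))
     + (2^-1 * (g x * h x * cos (2 * pi * (z + 1)%:~R * x + (th - 2 * pi * x0)))
     + 2^-1 * (g x * h x * cos (2 * pi * (z - 1)%:~R * x + (th + 2 * pi * x0)))))).
    apply: eq_cint => x.
    rewrite (_ : 2 * pi * (z + 1)%:~R * x + (th - 2 * pi * x0) =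
      (2 * pi * z%:~R * x + th) + 2 * pi * (x - x0)); last by rewrite intrD; ring.
    rewrite (_ : 2 * pi * (z - 1)%:~R * x + (th + 2 * pi * x0) =
      (2 * pi * z%:~R * x + th) - 2 * pi * (x - x0)); last by rewrite intrD; ring.
    set A := _ + th; set B := 2 * pi * _.
    by rewrite (cosD A B) (cosB A B); field.
  by rewrite cintD ?cintD ?cintZ ?Zh ?mulr0 ?addr0//; cont.
have peak g' x0 : continuous g' -> periodic g' 1 -> D x0 -> 0 < g' x0 ->
    ~ (forall h, Z h -> cint (fun x => g' x * h x) = 0).
  move=> cg' pg' Dx0 gx0 HZ.
  have [eta /andP[eta1 eta2] etaP] := periodic_pos_near cg' pg' gx0.
  (* The peak value is 2 - eta > 1; where the cosine is at most eta, [t] lies between -eta and 1. *)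
  pose t x : R := (1 - eta) + cos (2 * pi * (x - x0)).
  apply: (@cint_peak g' t x0) => //.
  - by rewrite /t; cont.
  - by rewrite /t subrr mulr0 cos0; lra.
  - move=> x Dx; have [c0|c0] := lerP (cos (2 * pi * (x - x0))) eta.
      left; rewrite /t ler_norml; have := cos_geN1 (2 * pi * (x - x0)).
      by move=> ?; apply/andP; split; lra.
    by right; split; [rewrite /t; lra|exact/ltW/etaP].
  - move=> n; apply: HZ; elim: n => [|n ih].
      by under [X in Z X]eq_fun do rewrite expr0.
    by under [X in Z X]eq_fun do rewrite exprSr; apply: ZS.
have Z0 h : Z h -> cint (fun x => g x * h x) = 0.
  move=> [ch /(_ 0 0) <-]; apply: eq_cint => x.
  by rewrite mulr0 mul0r addr0 cos0 mulr1.
apply: periodic_eq0 => // x Dx; apply/eqP; rewrite eq_le !leNgt.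
apply/andP; split; apply/negP => gx; last first.
  apply: (@peak (fun x => - g x) x) => //; first by cont.
  - by move=> y; rewrite pg.
  - lra.
  move=> h Zh; rewrite -[RHS](mulr0 (-1)) -(Z0 h Zh) -(cintZ (-1)).
    by apply: eq_cint => y; ring.
  by case: Zh => *; cont.
exact: (peak g x).
Qed.

End uniqueness.

(** * Uniform limits, the Weierstrass test and termwise differentiation *)

Section uniform_limits.
Variable R : realType.
Implicit Types (f g : R -> R) (s ds : nat -> R -> R).

Local Notation D := (@circle_dom R).

Definition ucv (s : nat -> R -> R) f := forall e : R, 0 < e ->
  exists M0, forall M, (M0 <= M)%N -> forall x, `|f x - s M x| <= e.

Lemma ucv_continuous s f : (forall M, continuous (s M)) -> ucv s f -> continuous f.
Proof.
move=> cs sf x; apply/cvgrPdist_le => e e0.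
have [M sM] : exists M, forall x, `|f x - s M x| <= e / 4.
  by have [|M /(_ M (leqnn M))] := sf (e / 4); [lra|exists M].
have : \forall y \near x, `|s M x - s M y| <= e / 4.
  by move/cvgrPdist_le : (cs M x); apply; lra.
apply: filterS => y sxy; move: (sM x) (sM y) sxy.
by rewrite !ler_norml; lra.
Qed.

Lemma ucv_cint s f h : (forall M, continuous (s M)) -> continuous h -> ucv s f ->
  forall e, 0 < e -> exists M0, forall M, (M0 <= M)%N ->
   `|cint (fun x => f x * h x) - cint (fun x => s M x * h x)| <= e.
Proof.
move=> cs ch sf e e0; have cf := ucv_continuous cs sf.
have [H H0 hH] := circle_bounded ch.
have [|M0 sM] := sf (e / (H + 1)); first by apply: divr_gt0 => //; lra.
exists M0 => M MM; rewrite -cintB; [|by cont|by have := cs M => ?; cont].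
apply: cint_norm_le => [|x Dx]; first by have := cs M => ?; cont.
rewrite -mulrBl normrM -[e](@divfK _ (H + 1)); last by lra.
by apply: ler_pM => //; [exact: sM|apply: le_trans (hH x Dx) _; lra].
Qed.

Lemma ucv_bound s f K : (forall M x, `|s M x| <= K) -> ucv s f -> forall x, `|f x| <= K.
Proof.
move=> sK sf x; apply/ler_addgt0Pr => e e0.
have [M /(_ M (leqnn M) x)] := sf e e0.
by move: (sK M x); rewrite !ler_norml; lra.
Qed.

(** The pointwise sum exists by absolute convergence, and its tail is dominated by the tail of [m],
    which does not depend on x. *)
Lemma weierstrass_mtest (p : nat -> R -> R) (m : nat -> R) K :
  (forall n x, `|p n x| <= m n) -> (forall M, \sum_(i < M) m i <= K) ->
  exists f, ucv (fun M x => \sum_(i < M) p i x) f.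
Proof.
move=> pm mK.
have m0 n : 0 <= m n by apply: le_trans (pm n 0).
have cm : cvgn (series m).
  apply: nondecreasing_is_cvgn; first by apply: nondecreasing_series => *.
  by exists K => _ [M _ <-]; rewrite /series/= big_mkord.
have cp x : cvgn (series (fun n => p n x)).
  apply: normed_cvg; apply: (series_le_cvg _ m0 _ cm) => n //=.
exists (fun x => limn (series (fun n => p n x))) => e e0.
have /cvgrPdist_le/(_ e e0)[M0 _ M0P] := cm.
exists M0 => M MM x; apply/ler_addgt0Pr => d d0.
have /cvgrPdist_le/(_ d d0)[N _ NP] := cp x.
pose n := maxn M N.
have := NP n (leq_maxr _ _); set l := limn _.
have := M0P M MM; set lm := limn _ => lmM.
have lmn : series m n <= lm.
  by apply: nondecreasing_cvgn_le => //; apply: nondecreasing_series.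
have Mn : (M <= n)%N by exact: leq_maxl.
have : `|series (fun i => p i x) n - series (fun i => p i x) M| <= series m n - series m M.
  rewrite !sub_series_geq//; apply: le_trans (ler_norm_sum _ _ _) _.
  by apply: ler_sum => i _.
move: lmM; rewrite {3}/series/= big_mkord !ler_norml; lra.
Qed.

(** Without the division by h the estimate includes h = 0 and becomes linear arithmetic. *)
Lemma is_derive_eps f (x df : R) :
  (forall e, 0 < e -> exists2 d, 0 < d & forall h : R, `|h| < d ->
     `|f (x + h) - f x - h * df| <= e * `|h|) <-> is_derive x (1 : R) f df.
Proof.
split=> [H|[fx fdf] e e0].
  have cf : (fun h => h^-1 *: (f (h *: (1 : R) + x) - f x)) @ (0 : R)^' --> df.
    apply/cvgrPdist_le => e e0; have [d d0 dP] := H e e0.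
    near=> h; have h0 : h != 0 by near: h; exact: nbhs_dnbhs_neq.
    have hd : `|h| < d by near: h; apply: dnbhs0_lt.
    rewrite -normrN opprB [h *: 1]mulr1 [h + x]addrC /GRing.scale/=.
    rewrite -(ler_pM2r (_ : 0 < `|h|)) ?normr_gt0// -normrM mulrBl.
    by rewrite mulrAC mulVf// mul1r (mulrC df); exact: dP.
  split; first by apply/cvg_ex; exists df.
  exact: (cvg_lim (@Rhausdorff R)).
have /cvgrPdist_le/(_ e e0) : (fun h => h^-1 *: (f (h *: (1 : R) + x) - f x)) @ (0 : R)^' --> df.
  by rewrite -fdf.
rewrite near_withinE => /nbhs_ballP[d /= d0 dP]; exists d => // h hd.
have [->|h0] := eqVneq h 0; first by rewrite addr0 subrr mul0r subr0 normr0 mulr0.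
have := dP h; rewrite /ball/= sub0r normrN => /(_ hd h0).
rewrite -normrN opprB [h *: 1]mulr1 [h + x]addrC /GRing.scale/=.
rewrite -(ler_pM2r (_ : 0 < `|h|)) ?normr_gt0// -normrM mulrBl.
by rewrite mulrAC mulVf// mul1r (mulrC df).
Unshelve. all: by end_near. Qed.

Lemma is_derive_continuous f df : (forall x : R, is_derive x (1 : R) f (df x)) -> continuous f.
Proof.
move=> dF x; apply: differentiable_continuous; apply/derivable1_diffP.
by case: (dF x).
Qed.

Lemma mean_value_le f df B : (forall x : R, is_derive x (1 : R) f (df x)) ->
  (forall x, `|df x| <= B) -> forall x y, `|f y - f x| <= B * `|y - x|.
Proof.
move=> fdf dfB.
suff H x y : x <= y -> `|f y - f x| <= B * `|y - x|.
  by move=> x y; have [/H//|/ltW/H] := leP x y; rewrite distrC (distrC x).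
move=> xy; have [|c _ ->] := @MVT_segment R f df x y xy (fun z _ => fdf z).
  exact/continuous_subspaceT/(is_derive_continuous fdf).
by rewrite normrM ler_wpM2r.
Qed.

Lemma ucv_derive s ds f df : (forall M x, is_derive x (1 : R) (s M) (ds M x)) ->
  ucv s f -> ucv ds df -> forall x : R, is_derive x (1 : R) f (df x).
Proof.
move=> sds sf dsf x; apply/is_derive_eps => e e0.
have [|M MP] := dsf (e / 4); first by lra.
have [|d d0 dP] := (is_derive_eps (s M) x (ds M x)).2 (sds M x) (e / 4); first by lra.
exists d => // h hd.
(* The mean value theorem bounds the increment of [s n] - [s M] for n >= M. Here n may depend on h,
   and letting it grow replaces [s n] by [f]. *)
have A : `|f (x + h) - s M (x + h) - (f x - s M x)| <= e / 2 * `|h|.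
  apply/ler_addgt0Pr => eta eta0.
  have [|N NP] := sf (eta / 2); first by lra.
  pose n := maxn M N.
  have := @mean_value_le (fun y => s n y - s M y) (fun y => ds n y - ds M y) (e / 2)
    _ _ x (x + h).
  have -> : x + h - x = h by ring.
  have d1 (y : R) : is_derive y (1 : R) (fun y => s n y - s M y) (ds n y - ds M y).
    exact: is_deriveB.
  have d2 y : `|ds n y - ds M y| <= e / 2.
    move: (MP n (leq_maxl _ _) y) (MP M (leqnn _) y).
    by rewrite !ler_norml; lra.
  move=> /(_ d1 d2).
  move: (NP n (leq_maxr _ _) x) (NP n (leq_maxr _ _) (x + h)).
  by rewrite !ler_norml; lra.
have B : `|h * (df x - ds M x)| <= e / 4 * `|h|.
  by rewrite normrM mulrC ler_wpM2r//; exact: MP.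
move: A B (dP h hd); rewrite !ler_norml; lra.
Qed.

End uniform_limits.

(** * Real Fourier series and their absolute convergence *)

Section trigonometric_series.
Variable R : realType.
Implicit Types (f g : R -> R) (a b : nat -> R).

Local Notation D := (@circle_dom R).

Definition fcos g (n : nat) : R := cint (fun x => g x * cos (2 * pi * n%:R * x)).
Definition fsin g (n : nat) : R := cint (fun x => g x * sin (2 * pi * n%:R * x)).

(** The factor 2 collects the frequencies n and -n of a real function, so that [a] and [b] are the
    plain integrals [fcos] and [fsin]. *)
Definition trig_term a b (n : nat) (x : R) : R :=
  (if n == 0%N then 1 else 2) *
  (a n * cos (2 * pi * n%:R * x) + b n * sin (2 * pi * n%:R * x)).

Definition trig_sum a b (M : nat) (x : R) : R := \sum_(n < M) trig_term a b n x.

Lemma trig_term_continuous a b n : continuous (trig_term a b n).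
Proof. by rewrite /trig_term; cont. Qed.

Lemma trig_sum_continuous a b M : continuous (trig_sum a b M).
Proof. exact/cont_sum/trig_term_continuous. Qed.

Lemma cos_natpi (n : nat) (x : R) : cos (2 * pi * n%:R * (x + 1)) = cos (2 * pi * n%:R * x).
Proof.
rewrite mulrDr mulr1 (_ : 2 * pi * n%:R = (pi *+ 2) *+ n).
  exact: (periodicn (@cosD2pi R)).
by rewrite -(mulr_natr (pi *+ 2) n) -(mulr_natr pi 2); ring.
Qed.

Lemma sin_natpi (n : nat) (x : R) : sin (2 * pi * n%:R * (x + 1)) = sin (2 * pi * n%:R * x).
Proof.
rewrite mulrDr mulr1 (_ : 2 * pi * n%:R = (pi *+ 2) *+ n).
  exact: (periodicn (@sinD2pi R)).
by rewrite -(mulr_natr (pi *+ 2) n) -(mulr_natr pi 2); ring.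
Qed.

Lemma trig_sum_periodic a b M : periodic (trig_sum a b M) 1.
Proof.
by move=> x; apply: eq_bigr => n _; rewrite /trig_term cos_natpi sin_natpi.
Qed.

Lemma is_derive_cos_lin (w x : R) :
  is_derive x (1 : R) (fun y => cos (w * y)) (- w * sin (w * x)).
Proof.
have d : is_derive x (1 : R) (fun y => w * y) w.
  by apply: is_derive_eq; rewrite /GRing.scale/= mulr1.
apply: (@is_derive_eq _ _ _ _ _ _ _ _ (is_derive1_comp (is_derive_cos _) d)).
by rewrite !(mulNr, mulrN) mulrC.
Qed.

Lemma is_derive_sin_lin (w x : R) :
  is_derive x (1 : R) (fun y => sin (w * y)) (w * cos (w * x)).
Proof.
have d : is_derive x (1 : R) (fun y => w * y) w.
  by apply: is_derive_eq; rewrite /GRing.scale/= mulr1.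
apply: (@is_derive_eq _ _ _ _ _ _ _ _ (is_derive1_comp (is_derive_sin _) d)).
by rewrite mulrC.
Qed.

Lemma cint_cos (n : nat) : cint (fun x : R => cos (2 * pi * n%:R * x)) = (n == 0%N)%:R.
Proof.
have [->|n0] := eqVneq n 0%N.
  rewrite -[RHS]cint_cst; apply: eq_cint => x.
  by rewrite mulr0 mul0r cos0.
pose w : R := 2 * pi * n%:R.
have w0 : w != 0 by rewrite !mulf_neq0// ?pnatr_eq0// gt_eqF// pi_gt0.
apply: (@cint_derive_periodic _ (fun x => w^-1 * sin (w * x))).
- by move=> x; rewrite sin_natpi.
- move=> x; have d := is_derive_sin_lin w x; apply: is_derive_eq.
  by rewrite /GRing.scale/= mulrA mulVf// mul1r.
- by cont.
Qed.

Lemma cint_sin (n : nat) : cint (fun x : R => sin (2 * pi * n%:R * x)) = 0.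
Proof.
have [->|n0] := eqVneq n 0%N.
  rewrite -[RHS]cint_cst; apply: eq_cint => x.
  by rewrite mulr0 mul0r sin0.
pose w : R := 2 * pi * n%:R.
have w0 : w != 0 by rewrite !mulf_neq0// ?pnatr_eq0// gt_eqF// pi_gt0.
apply: (@cint_derive_periodic _ (fun x => - w^-1 * cos (w * x))).
- by move=> x; rewrite cos_natpi.
- move=> x; have d := is_derive_cos_lin w x; apply: is_derive_eq.
  by rewrite /GRing.scale/= mulrA mulrNN mulVf// mul1r.
- by cont.
Qed.

(** Product to sum with natural frequencies |n - m| and n + m. With truncated subtraction, |n - m|
    is (n - m) + (m - n). When k and l vanish decides the orthogonality relations. *)
Lemma trig_product (n m : nat) : exists k l : nat,
  [/\ (k == 0%N) = (n == m), (l == 0%N) = (n == 0%N) && (m == 0%N) &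
  forall x : R, let c (j : nat) := cos (2 * pi * j%:R * x) in
                let s (j : nat) := sin (2 * pi * j%:R * x) in
    [/\ c n * c m = (c k + c l) / 2, s n * s m = (c k - c l) / 2 &
       c n * s m = (s l + (if (n <= m)%N then 1 else -1) * s k) / 2]].
Proof.
exists ((n - m) + (m - n))%N, (n + m)%N; split; [lia|lia|move=> x c s].
have E : s (n - m + (m - n))%N = (if (n <= m)%N then -1 else 1) *
    sin (2 * pi * n%:R * x - 2 * pi * m%:R * x) /\
   c (n - m + (m - n))%N = cos (2 * pi * n%:R * x - 2 * pi * m%:R * x).
  rewrite /s /c; case: leqP => nm.
    rewrite (_ : (n - m)%N = 0%N) ?add0n; last by apply/eqP; rewrite subn_eq0.
    rewrite natrB// mulN1r -sinN -(cosN (2 * pi * n%:R * x - 2 * pi * m%:R * x)).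
    by split; [congr sin|congr cos]; ring.
  rewrite (_ : (m - n)%N = 0%N) ?addn0; last by apply/eqP; rewrite subn_eq0 ltnW.
  by rewrite natrB ?(ltnW nm)// mul1r; split; [congr sin|congr cos]; ring.
case: E => -> ->.
have -> : c (n + m)%N = cos (2 * pi * n%:R * x + 2 * pi * m%:R * x).
  by rewrite /c natrD; congr cos; ring.
have -> : s (n + m)%N = sin (2 * pi * n%:R * x + 2 * pi * m%:R * x).
  by rewrite /s natrD; congr sin; ring.
rewrite cosB sinB cosD sinD -/(c n) -/(c m) -/(s n) -/(s m).
by split; try (case: ifP => _); field.
Qed.

Lemma cint_cos_cos (n m : nat) :
  (if n == 0%N then 1 else 2) *
  cint (fun x : R => cos (2 * pi * n%:R * x) * cos (2 * pi * m%:R * x)) = (n == m)%:R.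
Proof.
have [k [l [k0 l0 E]]] := trig_product n m.
rewrite (_ : cint _ = cint (fun x : R => 2^-1 * cos (2 * pi * k%:R * x) + 2^-1 * cos (2 * pi * l%:R * x))).
  rewrite cintD ?cintZ; try by cont.
  rewrite !cint_cos k0 l0; case: (eqVneq n m) => [nm|nm].
    by subst m; case: (eqVneq n 0%N) => _ /=; field.
  case: (eqVneq n 0%N) => [n0|_] /=; last by field.
  have -> : (m == 0%N) = false by apply/negbTE; rewrite eq_sym -n0.
  by rewrite !mulr0 addr0 mulr0.
by apply: eq_cint => x; case: (E x) => -> _ _; field.
Qed.

(** For n = m = 0 the integral is 0 rather than 1, hence the restriction on m. *)
Lemma cint_sin_sin (n m : nat) : (0 < m)%N ->
  (if n == 0%N then 1 else 2) *
  cint (fun x : R => sin (2 * pi * n%:R * x) * sin (2 * pi * m%:R * x)) = (n == m)%:R.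
Proof.
move=> m0; have [k [l [k0 l0 E]]] := trig_product n m.
rewrite (_ : cint _ = cint (fun x : R => 2^-1 * cos (2 * pi * k%:R * x) - 2^-1 * cos (2 * pi * l%:R * x))).
  rewrite cintB ?cintZ; try by cont.
  rewrite !cint_cos k0 l0 (gtn_eqF m0) andbF.
  case: (eqVneq n m) => [->|_]; last by rewrite subrr mulr0.
  by rewrite (gtn_eqF m0)/= mulr0 subr0 mulr1; field.
by apply: eq_cint => x; case: (E x) => _ -> _; field.
Qed.

Lemma cint_cos_sin (n m : nat) :
  cint (fun x : R => cos (2 * pi * n%:R * x) * sin (2 * pi * m%:R * x)) = 0.
Proof.
have [k [l [k0 l0 E]]] := trig_product n m.
rewrite (_ : cint _ = cint (fun x : R => 2^-1 * sin (2 * pi * l%:R * x) +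
     2^-1 * (if (n <= m)%N then 1 else -1) * sin (2 * pi * k%:R * x))).
  rewrite cintD ?cintZ; try by cont.
  by rewrite !cint_sin !mulr0 addr0.
by apply: eq_cint => x; case: (E x) => _ _ ->; case: ifP => _; field.
Qed.

Lemma cint_trig_sum a b M h : continuous h ->
  cint (fun x => trig_sum a b M x * h x) =
  \sum_(n < M) (if n == 0%N :> nat then 1 else 2) * (a n * fcos h n + b n * fsin h n).
Proof.
move=> ch.
rewrite (_ : cint _ = cint (fun x => \sum_(n < M) trig_term a b n x * h x)); last first.
  by apply: eq_cint => x; rewrite mulr_suml.
rewrite (@cint_sum _ M (fun n x => trig_term a b n x * h x)); last by move=> i; apply: contM => //; exact: trig_term_continuous.
apply: eq_bigr => n _; set w := (if _ then _ else _).
transitivity (cint (fun x => w * a n * (h x * cos (2 * pi * n%:R * x)) +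
    w * b n * (h x * sin (2 * pi * n%:R * x)))).
  by apply: eq_cint => x; rewrite /trig_term -/w; ring.
rewrite cintD ?cintZ; try by cont.
by rewrite /fcos /fsin; ring.
Qed.

Lemma fcos_trig_sum a b M m : (m < M)%N -> fcos (trig_sum a b M) m = a m.
Proof.
move=> mM; rewrite /fcos cint_trig_sum; last by cont.
rewrite (bigD1 (Ordinal mM))//= big1 => [|i im].
  rewrite addr0 /fcos /fsin mulrDr mulrCA cint_cos_cos eqxx mulr1.
  by rewrite cint_cos_sin !mulr0 addr0.
rewrite /fcos /fsin mulrDr mulrCA.
rewrite (_ : cint _ = cint (fun x : R => cos (2 * pi * i%:R * x) * cos (2 * pi * m%:R * x))).
  rewrite cint_cos_cos cint_cos_sin !mulr0 addr0 (_ : (i == m :> nat) = false) ?mulr0//.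
  by apply/negbTE; apply: contraNneq im => im; apply/eqP/val_inj.
by apply: eq_cint => x; rewrite mulrC.
Qed.

Lemma fsin_trig_sum a b M m : (0 < m < M)%N -> fsin (trig_sum a b M) m = b m.
Proof.
move=> /andP[m0 mM]; rewrite /fsin cint_trig_sum; last by cont.
have E n : fcos (fun x : R => sin (2 * pi * m%:R * x)) n = 0.
  rewrite -[RHS](cint_cos_sin n m); apply: eq_cint => x; exact: mulrC.
rewrite (bigD1 (Ordinal mM))//= big1 => [|i im].
  by rewrite addr0 E mulr0 add0r mulrCA cint_sin_sin// eqxx mulr1.
rewrite E mulr0 add0r mulrCA /fsin.
rewrite (_ : cint _ = cint (fun x : R => sin (2 * pi * i%:R * x) * sin (2 * pi * m%:R * x))).
  rewrite cint_sin_sin// (_ : (i == m :> nat) = false) ?mulr0//.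
  by apply/negbTE; apply: contraNneq im => im; apply/eqP/val_inj.
by apply: eq_cint => x; rewrite mulrC.
Qed.

Lemma ucv_fcos a b g : ucv (trig_sum a b) g -> forall m, fcos g m = a m.
Proof.
move=> ag m; apply/eqP; rewrite -subr_eq0 -normr_le0; apply/ler_addgt0Pr => e e0.
have ch : continuous (fun x : R => cos (2 * pi * m%:R * x)) by cont.
have [M0 MP] := ucv_cint (@trig_sum_continuous a b) ch ag e0.
by rewrite add0r -(@fcos_trig_sum a b (maxn M0 m.+1) m) ?leq_maxr//; apply: MP; rewrite leq_maxl.
Qed.

Lemma fsin0 g : fsin g 0 = 0.
Proof.
rewrite -[RHS](cint_cst (0 : R)); apply: eq_cint => x.
by rewrite mulr0 mul0r sin0 mulr0.
Qed.

Lemma ucv_fsin a b g : ucv (trig_sum a b) g -> forall m, (0 < m)%N -> fsin g m = b m.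
Proof.
move=> ag m m0; apply/eqP; rewrite -subr_eq0 -normr_le0; apply/ler_addgt0Pr => e e0.
have ch : continuous (fun x : R => sin (2 * pi * m%:R * x)) by cont.
have [M0 MP] := ucv_cint (@trig_sum_continuous a b) ch ag e0.
rewrite add0r -(@fsin_trig_sum a b (maxn M0 m.+1) m); last by rewrite m0 leq_maxr.
by apply: MP; rewrite leq_maxl.
Qed.

Lemma trig_term_le a b n x : `|trig_term a b n x| <= 2 * (`|a n| + `|b n|).
Proof.
rewrite /trig_term normrM; apply: ler_pM => //.
  by case: ifP => _; rewrite ger0_norm//; lra.
apply: le_trans (ler_normD _ _) _; rewrite !normrM.
by apply: lerD; rewrite -[X in _ <= X]mulr1 ler_wpM2l// ?cos_max ?sin_max.
Qed.

Lemma trig_series_ucv a b K : (forall M, \sum_(n < M) (`|a n| + `|b n|) <= K) ->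
  exists g, ucv (trig_sum a b) g.
Proof.
move=> abK; apply: (@weierstrass_mtest R _ (fun n => 2 * (`|a n| + `|b n|)) (2 * K)).
  exact: trig_term_le.
by move=> M; rewrite -mulr_sumr ler_wpM2l.
Qed.

Lemma trig_sum_le a b K : (forall M, \sum_(n < M) (`|a n| + `|b n|) <= K) ->
  forall M x, `|trig_sum a b M x| <= 2 * K.
Proof.
move=> abK M x; apply: le_trans (ler_norm_sum _ _ _) _.
apply: (@le_trans _ _ (\sum_(n < M) 2 * (`|a n| + `|b n|))).
  by apply: ler_sum => i _; exact: trig_term_le.
by rewrite -mulr_sumr ler_wpM2l.
Qed.

Lemma ucv_periodic a b g : ucv (trig_sum a b) g -> periodic g 1.
Proof.
move=> ag x; apply/eqP; rewrite -subr_eq0 -normr_le0; apply/ler_addgt0Pr => e e0.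
have [|M /(_ M (leqnn M)) MP] := ag (e / 2); first by lra.
have := MP (x + 1); rewrite trig_sum_periodic; move: (MP x).
by rewrite !ler_norml; lra.
Qed.

(** The series converges uniformly to some continuous [f]; [f] has the coefficients of [g], so they
    agree by uniqueness. *)
Lemma fourier_series_ucv g K : continuous g -> periodic g 1 ->
  (forall M, \sum_(n < M) (`|fcos g n| + `|fsin g n|) <= K) ->
  ucv (trig_sum (fcos g) (fsin g)) g.
Proof.
move=> cg pg gK; have [f gf] := trig_series_ucv gK.
have cf := ucv_continuous (@trig_sum_continuous _ _) gf.
suff : forall x, g x - f x = 0.
  move=> gf0; have fg : f = g by apply/funext => x; apply/esym/subr0_eq.
  by rewrite fg in gf.
apply: circle_integral_trig_eq0; first by cont.
- by move=> x; rewrite pg (ucv_periodic gf).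
- move=> n; rewrite (_ : cint _ = fcos g n - fcos f n); first by rewrite (ucv_fcos gf) subrr.
  by rewrite -cintB; try cont; apply: eq_cint => x; rewrite mulrBl.
- move=> n; rewrite (_ : cint _ = fsin g n - fsin f n).
    case: n => [|n]; first by rewrite !fsin0 subrr.
    by rewrite (ucv_fsin gf)// subrr.
  by rewrite -cintB; try cont; apply: eq_cint => x; rewrite mulrBl.
Qed.

Lemma is_derive_trig_sum a b M (x : R) : is_derive x (1 : R) (trig_sum a b M)
  (trig_sum (fun n => 2 * pi * n%:R * b n) (fun n => - (2 * pi * n%:R * a n)) M x).
Proof.
rewrite /trig_sum; elim: M => [|M ih].
  under eq_fun do rewrite big_ord0; rewrite big_ord0; exact: is_derive_cst.
under eq_fun do rewrite big_ord_recr/=; rewrite big_ord_recr/=.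
apply: is_deriveD.
have d1 := is_derive_cos_lin (2 * pi * M%:R) x.
have d2 := is_derive_sin_lin (2 * pi * M%:R) x.
by rewrite /trig_term; apply: is_derive_eq; rewrite /GRing.scale/=; ring.
Qed.

(** The weight 1 + n^2 dominates both n and n^2, so the series differentiated once and twice still
    converge absolutely. The bounds are linear in [K], so a small Sobolev norm will mean a small C^1
    norm. *)
Lemma fourier_C2 g K : continuous g -> periodic g 1 ->
  (forall M, \sum_(n < M) (1 + n%:R ^+ 2) * (`|fcos g n| + `|fsin g n|) <= K) ->
  exists g1 g2, [/\ forall x : R, is_derive x (1 : R) g (g1 x),
    forall x : R, is_derive x (1 : R) g1 (g2 x), continuous g2, periodic g2 1 &
    [/\ forall n, fcos g2 n = - (2 * pi * n%:R) ^+ 2 * fcos g n,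
     forall n, fsin g2 n = - (2 * pi * n%:R) ^+ 2 * fsin g n,
     forall x, `|g x| <= 2 * K,
     forall x, `|g1 x| <= 2 * (2 * pi * K) &
     exists K2, forall M, \sum_(n < M) (`|fcos g2 n| + `|fsin g2 n|) <= K2]].
Proof.
move=> cg pg gK; set A := fcos g; set B := fsin g.
have pi0 := @pi_gt0 R.
have n0 (n : nat) : 0 <= (n%:R : R) by [].
have le_n (n : nat) : n%:R <= 1 + n%:R ^+ 2 :> R by have := n0 n; nra.
have AB0 n : 0 <= `|A n| + `|B n| by apply: addr_ge0.
have K0 M : \sum_(n < M) (`|A n| + `|B n|) <= K.
  apply: le_trans (gK M); apply: ler_sum => i _; rewrite ler_peMl//.
  by rewrite lerDl sqr_ge0.
pose w (n : nat) : R := 2 * pi * n%:R.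
have w0 n : 0 <= w n by rewrite !mulr_ge0// ltW.
pose a1 n := w n * B n; pose b1 n := - (w n * A n).
pose a2 n := w n * b1 n; pose b2 n := - (w n * a1 n).
have K1 M : \sum_(n < M) (`|a1 n| + `|b1 n|) <= 2 * pi * K.
  apply: (@le_trans _ _ (2 * pi * \sum_(n < M) (1 + n%:R ^+ 2) * (`|A n| + `|B n|))).
    rewrite mulr_sumr; apply: ler_sum => n _.
    rewrite /a1 /b1 normrN (normrM (w n) (A n)) (normrM (w n) (B n)) (ger0_norm (w0 n)) -mulrDr addrC mulrA.
    by rewrite ler_wpM2r// /w ler_pM2l// mulr_gt0.
  by rewrite ler_pM2l// mulr_gt0.
have K2 M : \sum_(n < M) (`|a2 n| + `|b2 n|) <= (2 * pi) ^+ 2 * K.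
  apply: (@le_trans _ _ ((2 * pi) ^+ 2 * \sum_(n < M) (1 + n%:R ^+ 2) * (`|A n| + `|B n|))).
    rewrite mulr_sumr; apply: ler_sum => n _.
    rewrite /a2 /b2 /a1 /b1 normrN (normrM (w n) (- _)) (normrM (w n) (w n * _)) normrN.
    rewrite (normrM (w n) (A n)) (normrM (w n) (B n)) (ger0_norm (w0 n)) -!mulrDr.
    rewrite (mulrA (w n) (w n)) (mulrA ((2 * pi) ^+ 2)) -(expr2 (w n)) ler_wpM2r// /w exprMn ler_wpM2l ?sqr_ge0//.
    by rewrite lerDr.
  by rewrite ler_wpM2l ?sqr_ge0.
have s0 := fourier_series_ucv cg pg K0.
have [g1 s1] := trig_series_ucv K1.
have [g2 s2] := trig_series_ucv K2.
have c2 : forall n, fcos g2 n = - (2 * pi * n%:R) ^+ 2 * fcos g n.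
  by move=> n; rewrite (ucv_fcos s2) /a2 /b1 -/A /w; ring.
have f2 : forall n, fsin g2 n = - (2 * pi * n%:R) ^+ 2 * fsin g n.
  case=> [|n]; first by rewrite !fsin0 mulr0.
  by rewrite (ucv_fsin s2)// /b2 /a1 -/B /w; ring.
exists g1, g2; split.
- exact: (ucv_derive (is_derive_trig_sum _ _) s0 s1).
- exact: (ucv_derive (is_derive_trig_sum _ _) s1 s2).
- exact: (ucv_continuous (@trig_sum_continuous _ _) s2).
- exact: ucv_periodic s2.
- split => //.
  + exact: (ucv_bound (trig_sum_le K0) s0).
  + exact: (ucv_bound (trig_sum_le K1) s1).
  + exists ((2 * pi) ^+ 2 * K) => M; apply: le_trans (K2 M).
    apply: ler_sum => n _; rewrite (ucv_fcos s2) lerD2l.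
    by case: (n : nat) => [|m]; [rewrite fsin0 normr0|rewrite (ucv_fsin s2)].
Qed.

End trigonometric_series.

(** * From Sobolev norms to absolutely summable Fourier coefficients *)

Section sobolev.
Variable R : realType.
Implicit Types (f g : R -> R) (A : nat -> R).

(** A discrete integral comparison. With y = n + 1 and z = n + 2, y^(-a) = z^(-a) exp(a (ln z - ln
    y)), where exp(v) >= 1 + v and ln z - ln y = -ln(1 - 1/z) >= 1/z. *)
Lemma powR_telescope (a : R) n : 0 < a ->
  n.+2%:R `^ (- a - 1) <= a^-1 * (n.+1%:R `^ (- a) - n.+2%:R `^ (- a)).
Proof.
move=> a0; pose y : R := n.+1%:R; pose z : R := n.+2%:R.
have y0 : 0 < y by rewrite ltr0n.
have z0 : 0 < z by rewrite ltr0n.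
have zy : z = y + 1 by rewrite /z /y -natr1.
rewrite -/y -/z ler_pdivlMl//.
have -> : z `^ (- a - 1) = z `^ (- a) / z.
  rewrite powRB; last by apply/implyP => _; rewrite gt_eqF.
  by rewrite powRr1// ltW.
have yz : y `^ (- a) = z `^ (- a) * expR (a * (ln z - ln y)).
  rewrite /powR !gt_eqF// -expRD; congr expR; ring.
rewrite yz -[X in _ <= _ - X]mulr1 -mulrBr mulrCA ler_pM2l ?powR_gt0//.
have l1 : z^-1 <= ln z - ln y.
  rewrite -opprB lerNr -ln_div ?posrE//.
  have -> : y / z = 1 + (- z^-1) by rewrite zy; field; lra.
  apply: le_ln1Dx; rewrite ltrN2 invf_lt1// /z ltr1n//.
rewrite lerBrDr addrC; apply: le_trans (expR_ge1Dx _).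
by rewrite lerD2l ler_pM2l.
Qed.

Lemma bessel_potential_summable (r : R) : 2^-1 < r ->
  exists Z, forall M, \sum_(n < M) ((1 + n%:R ^+ 2) `^ r)^-1 <= Z.
Proof.
move=> r2; pose a := 2 * r - 1; have a0 : 0 < a by rewrite /a; lra.
have p0 (n : nat) : 0 < (1 + n%:R ^+ 2) `^ r :> R.
  by apply: powR_gt0; rewrite ltr_pwDl// sqr_ge0.
have p1 (n : nat) : ((1 + n%:R ^+ 2) `^ r)^-1 <= 1 :> R.
  rewrite invf_le1//; apply: (@le_trans _ _ (1 `^ r)); first by rewrite powR1.
  by rewrite ge0_ler_powR ?nnegrE ?lerDl ?addr_ge0 ?sqr_ge0//; lra.
exists (2 + a^-1) => M.
apply: (@le_trans _ _ (\sum_(n < M.+2) ((1 + n%:R ^+ 2) `^ r)^-1)).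
  rewrite !big_ord_recr/= -addrA lerDl addr_ge0// invr_ge0 ltW//.
(* The terms n = 0 and n = 1 are at most 1 each; the others telescope, and keeping the telescoped
   remainder lets the induction close. *)
suff H : \sum_(n < M.+2) ((1 + n%:R ^+ 2) `^ r)^-1 <= 2 + a^-1 * (1 - M.+1%:R `^ (- a)).
  apply: le_trans H _; rewrite lerD2l ger_pMr ?invr_gt0//.
elim: M => [|M ih].
  rewrite !big_ord_recr big_ord0/= powR1 subrr mulr0 addr0 add0r.
  by apply: lerD; exact: (p1 _).
rewrite big_ord_recr/=; have := powR_telescope M a0.
have : ((1 + M.+2%:R ^+ 2) `^ r)^-1 <= M.+2%:R `^ (- a - 1) :> R.
  have -> : - a - 1 = - (2 * r) by rewrite /a; ring.
  rewrite powRN lef_pV2 ?posrE ?powR_gt0//.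
  rewrite powRrM powR_mulrn// ge0_ler_powR ?nnegrE ?sqr_ge0 ?addr_ge0 ?sqr_ge0//; lra.
move: ih; lra.
Qed.

(** Cauchy-Schwarz in additive form: with w the weight, |A n| <= d / w + w (A n)^2 / d termwise, and
    the two sums are at most Z d and d. *)
Lemma weighted_l2_l1 (r : R) : 2^-1 < r -> exists2 C, 0 < C &
  forall A (d : R), 0 < d ->
    (forall M, \sum_(n < M) (1 + n%:R ^+ 2) `^ r * A n ^+ 2 <= d ^+ 2) ->
    forall M, \sum_(n < M) `|A n| <= C * d.
Proof.
move=> r2; have [Z ZP] := bessel_potential_summable r2.
have Z0 : 0 <= Z by have := ZP 0%N; rewrite big_ord0.
exists (Z + 1); first by lra.
move=> A d d0 AP M.
pose w (n : nat) : R := (1 + n%:R ^+ 2) `^ r.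
have w0 n : 0 < w n by apply: powR_gt0; rewrite ltr_pwDl// sqr_ge0.
apply: (@le_trans _ _ (\sum_(n < M) (d * (w n)^-1 + d^-1 * (w n * A n ^+ 2)))).
  apply: ler_sum => n _.
  have := sqr_ge0 (d * (w n)^-1 - `|A n|).
  have E : d * (w n)^-1 + d^-1 * (w n * A n ^+ 2) =
    (w n / d) * ((d * (w n)^-1) ^+ 2 + `|A n| ^+ 2).
    by rewrite real_normK ?num_real//; field; rewrite !gt_eqF.
  rewrite E => H.
  have : 0 <= (w n / d) * ((d * (w n)^-1 - `|A n|) ^+ 2) by rewrite mulr_ge0// divr_ge0// ltW.
  have E2 : (w n / d) * ((d * (w n)^-1 - `|A n|) ^+ 2) =
     (w n / d) * ((d * (w n)^-1) ^+ 2 + `|A n| ^+ 2) - 2 * `|A n|.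
    by field; rewrite !gt_eqF.
  by rewrite E2; have := normr_ge0 (A n); lra.
rewrite big_split/= -!mulr_sumr mulrDl mul1r (mulrC Z); apply: lerD.
  by rewrite ler_pM2l//; exact: ZP.
by rewrite mulrC ler_pdivrMr//; exact: AP.
Qed.

(** This replaces the extended real norm by finite sums. Of the sum over all integers only the
    frequencies 0 <= n < M are kept. *)
Lemma sobolev_norm_partial (r : R) g (d : R) : 0 < d -> (sobolev_norm r g < d%:E)%E ->
  forall M, \sum_(n < M) (1 + n%:R ^+ 2) `^ r * (fcos g n ^+ 2 + fsin g n ^+ 2) <= d ^+ 2.
Proof.
move=> d0; rewrite /sobolev_norm; set S := (\esum_(_ in _) _)%E.
have S0 : (0 <= S)%E.
  by apply: esum_ge0 => n _; rewrite lee_fin mulr_ge0 ?powR_ge0 ?sqr_ge0.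
rewrite poweR12_sqrt// => Sd M; rewrite -lee_fin; apply: (@le_trans _ _ S); last first.
  move: S S0 Sd => [x||]//= x0; rewrite lte_fin => xd; rewrite lee_fin.
  rewrite -(@sqr_sqrtr _ x)// lerXn2r ?nnegrE ?sqrtr_ge0//; exact: ltW.
apply: esum_ge; exists (Posz @` `I_M); first by split => //; exact: finite_image.
have bij : set_bij `I_M (Posz @` `I_M) Posz.
  by split; [by move=> n nM; exists n|move=> x y _ _ []|exact: subset_refl].
rewrite (reindex_fsbig _ _ _ _ bij) -fsbig_ord sumEFin lee_fin.
apply: ler_sum => n _; rewrite -pmulrn.
rewrite ler_wpM2l ?powR_ge0// /ComplexField.Normc.normc /fourier_coef.
by rewrite sqr_sqrtr ?addr_ge0 ?sqr_ge0// sqrrN.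
Qed.

Lemma sobolev_l1 (r : R) : 2^-1 < r -> exists2 C, 0 < C &
  forall g (d : R), 0 < d -> (sobolev_norm r g < d%:E)%E ->
    forall M, \sum_(n < M) (`|fcos g n| + `|fsin g n|) <= C * d.
Proof.
move=> r2; have [C C0 CP] := weighted_l2_l1 r2; exists (2 * C); first by lra.
move=> g d d0 gd M; have := sobolev_norm_partial d0 gd.
rewrite big_split/= => H; rewrite -mulrA mulr_natl mulr2n; apply: lerD.
  apply: CP => // N; apply: le_trans (H N); apply: ler_sum => n _.
  by rewrite ler_wpM2l ?powR_ge0// lerDl sqr_ge0.
apply: CP => // N; apply: le_trans (H N); apply: ler_sum => n _.
by rewrite ler_wpM2l ?powR_ge0// lerDr sqr_ge0.
Qed.

(** The factor 1 + n^2 costs two derivatives, and s - 2 > 1/2 still leaves an absolutely convergent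
    series. *)
Lemma sobolev_weighted_l1 (s : R) : 5 / 2 < s -> exists2 C, 0 < C &
  forall g (d : R), 0 < d -> (sobolev_norm s g < d%:E)%E ->
    forall M, \sum_(n < M) (1 + n%:R ^+ 2) * (`|fcos g n| + `|fsin g n|) <= C * d.
Proof.
move=> s2; have [|C C0 CP] := @weighted_l2_l1 (s - 2); first by lra.
exists (2 * C); first by lra.
move=> g d d0 gd M; have H := sobolev_norm_partial d0 gd.
have n0 (n : nat) : 0 < 1 + n%:R ^+ 2 :> R by rewrite ltr_pwDl ?sqr_ge0.
have E (n : nat) (x : R) : (1 + n%:R ^+ 2) `^ (s - 2) * ((1 + n%:R ^+ 2) * x) ^+ 2 =
    (1 + n%:R ^+ 2) `^ s * x ^+ 2.
  rewrite exprMn mulrA -(powR_mulrn 2 (ltW (n0 n))) -powRD.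
    by rewrite subrK.
  by apply/implyP => _; rewrite gt_eqF.
under eq_bigr do rewrite mulrDr.
rewrite big_split/= -mulrA mulr_natl mulr2n; apply: lerD.
  rewrite (eq_bigr (fun n : 'I_M => `|(1 + n%:R ^+ 2) * fcos g n|)); last first.
    by move=> n _; rewrite normrM gtr0_norm.
  apply: (CP (fun n => (1 + n%:R ^+ 2) * fcos g n)) => // N.
  apply: le_trans (H N); apply: ler_sum => n _.
  by rewrite E ler_wpM2l ?powR_ge0// lerDl sqr_ge0.
rewrite (eq_bigr (fun n : 'I_M => `|(1 + n%:R ^+ 2) * fsin g n|)); last first.
  by move=> n _; rewrite normrM gtr0_norm.
apply: (CP (fun n => (1 + n%:R ^+ 2) * fsin g n)) => // N.
apply: le_trans (H N); apply: ler_sum => n _.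
by rewrite E ler_wpM2l ?powR_ge0// lerDr sqr_ge0.
Qed.

End sobolev.

(** * Bessel's inequality and the Riemann-Lebesgue lemma *)

Section bessel.
Variable R : realType.
Implicit Types (f g k : R -> R).

(** Expand the integral of (k - S)^2 >= 0: by orthogonality both S k and S^2 integrate to [Q], which
    counts positive frequencies twice and so dominates the left side. *)
Lemma bessel_inequality k M : continuous k ->
  \sum_(n < M) (fcos k n ^+ 2 + fsin k n ^+ 2) <= cint (fun x => k x ^+ 2).
Proof.
move=> ck; pose S := trig_sum (fcos k) (fsin k) M.
have cS : continuous S by exact: trig_sum_continuous.
pose Q := \sum_(n < M) (if n == 0%N :> nat then 1 else 2) *
  (fcos k n * fcos k n + fsin k n * fsin k n).
have Sk : cint (fun x => S x * k x) = Q by rewrite /S cint_trig_sum.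
have SS : cint (fun x => S x * S x) = Q.
  rewrite {1}/S cint_trig_sum//; apply: eq_bigr => n _; congr (_ * (_ * _ + _)).
    exact: fcos_trig_sum.
  case: n => -[|n] nM /=; first by rewrite !fsin0 !mulr0.
  by congr (_ * _); exact: fsin_trig_sum.
have : 0 <= cint (fun x => k x * k x + (S x * S x - 2 * (S x * k x))).
  by apply: Rintegral_ge0 => x _; have := sqr_ge0 (k x - S x); nra.
rewrite cintD ?cintB ?cintZ; try by cont.
rewrite Sk SS => H; apply: (@le_trans _ _ Q).
  apply: ler_sum => n _; rewrite -!expr2.
  have := sqr_ge0 (fcos k n); have := sqr_ge0 (fsin k n).
  by case: ifP => _; lra.
rewrite (_ : cint _ = cint (fun x => k x * k x)); last by apply: eq_cint => x; rewrite expr2.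
lra.
Qed.

Lemma riemann_lebesgue k : continuous k -> forall e, 0 < e ->
  exists N0, forall N, (N0 <= N)%N -> `|fcos k N| <= e /\ `|fsin k N| <= e.
Proof.
move=> ck e e0; pose u n := fcos k n ^+ 2 + fsin k n ^+ 2.
have u0 n : 0 <= u n by rewrite addr_ge0 ?sqr_ge0.
have cu : cvgn (series u).
  apply: nondecreasing_is_cvgn; first by apply: nondecreasing_series => *.
  exists (cint (fun x => k x ^+ 2)) => _ [M _ <-]; rewrite /series/= big_mkord.
  exact: bessel_inequality.
have /cvgrPdist_le/(_ (e ^+ 2)) := cvg_series_cvg_0 cu.
move=> /(_ (exprn_gt0 _ e0))[N0 _ N0P]; exists N0 => N /N0P.
rewrite sub0r normrN ger0_norm// /u => ue.
have := sqr_ge0 (fcos k N); have := sqr_ge0 (fsin k N) => *.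
by split; rewrite -(@ler_pXn2r _ 2)// ?nnegrE ?(ltW e0)// real_normK ?num_real//; lra.
Qed.

Lemma contV f : continuous f -> (forall x, f x != 0) -> continuous (fun x => (f x)^-1).
Proof. by move=> cf f0 x; apply: cvgV; [exact: f0|exact: cf]. Qed.

End bessel.

(** * A continuous cotangent coordinate and its moment problem *)

Section cotangent.
Variable R : realType.
Variable d : R.
Hypotheses (d0 : 0 < d) (d1 : d <= 2^-1).
Implicit Types (f g : R -> R).
Local Notation D := (@circle_dom R).

(** The least value of sin^2(pi y) for d <= |y| <= 1/2; its inverse bounds the truncated
    cotangent. *)
Definition cot_floor : R := sin (pi * d) ^+ 2.

(* The continuous function [cut_cot] coincides with [cot (pi * y)] when the distance from [y] to the integers is at least [d]. *)
Definition cut_cot (y : R) : R :=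
  cos (pi * y) * sin (pi * y) * (Num.max (sin (pi * y) ^+ 2) cot_floor)^-1.

Lemma sin_pid_gt0 : 0 < sin (pi * d).
Proof.
have pi0 := @pi_gt0 R; apply: sin_gt0_pi; rewrite mulr_gt0//=.
by rewrite gtr_pMr//; have := d1; lra.
Qed.

Lemma cot_floor_gt0 : 0 < cot_floor.
Proof. by rewrite exprn_gt0// sin_pid_gt0. Qed.

Lemma cut_cot_continuous : continuous cut_cot.
Proof.
have cm : continuous (fun y => Num.max (sin (pi * y) ^+ 2) cot_floor).
  under eq_fun do rewrite maxr_absE; by cont.
apply: contM; first by cont.
apply: contV => // x; rewrite gt_eqF// lt_max cot_floor_gt0 orbT//.
Qed.

Lemma cut_cot_bound y : `|cut_cot y| <= cot_floor^-1.
Proof.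
have m0 := cot_floor_gt0.
rewrite /cut_cot normrM normrM -[X in _ <= X]mul1r ler_pM//.
  by rewrite mulr_ile1// ?cos_max ?sin_max.
have M0 : 0 < Num.max (sin (pi * y) ^+ 2) cot_floor by rewrite lt_max m0 orbT.
by rewrite gtr0_norm ?invr_gt0// lef_pV2 ?posrE// le_max lexx orbT.
Qed.

Lemma cut_cotE y : D y -> d <= `|y| -> sin (pi * y) != 0 /\ cos (pi * y) = cut_cot y * sin (pi * y).
Proof.
rewrite /circle_dom/= in_itv/= => /andP[y1 y2] dy.
have pi0 := @pi_gt0 R; have [dd0 dd1] := (d0, d1).
have ip (z : R) : - 2^-1 <= z -> z <= 2^-1 -> pi * z \in `[(- (pi / 2)), pi / 2]%R.
  by move=> z1 z2; rewrite in_itv/= -mulrN !ler_pM2l// z1.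
have H : sin (pi * d) <= `|sin (pi * y)|.
  have [y0|y0] := leP 0 y.
    rewrite ger0_norm in dy => //; apply: le_trans (ler_norm _).
    by rewrite leNgt ltr_sin; [rewrite ltr_pM2l// -leNgt|apply: ip; lra|apply: ip; lra].
  rewrite ltr0_norm in dy => //; rewrite -normrN -sinN -mulrN; apply: le_trans (ler_norm _).
  by rewrite leNgt ltr_sin; [rewrite ltr_pM2l// -leNgt|apply: ip; lra|apply: ip; lra].
have s0 : sin (pi * y) != 0 by rewrite -normr_gt0; apply: lt_le_trans H; exact: sin_pid_gt0.
split => //; rewrite /cut_cot max_l; first by field.
rewrite -(@real_normK _ (sin (pi * y))) ?num_real// lerXn2r// nnegrE ?normr_ge0//.
exact/ltW/sin_pid_gt0.
Qed.

(** If [g] were positive at [y0], powers of a quadratic in [cut_cot] peaking at [y0] would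
    contradict the vanishing moments. The injectivity of the cotangent enters through sin(pi (y -
    y0)) = sin(pi y) sin(pi y0) (cot(pi y0) - cot(pi y)). *)
Lemma cot_moments_le0 g : continuous g -> periodic g 1 ->
  (forall y, `|y| < d -> g y = 0) ->
  (forall j, cint (fun y => g y * (1 + cut_cot y ^+ 2) * cut_cot y ^+ j) = 0) ->
  forall y, D y -> g y <= 0.
Proof.
move=> cg pg g0 gm y0 Dy0; rewrite leNgt; apply/negP => gy0.
have cc := cut_cot_continuous; have m0 := cot_floor_gt0.
have [eta /andP[eta1 eta2] etaP] := periodic_pos_near cg pg gy0.
(* Since |[cut_cot]| <= [cot_floor^-1], this makes ka (c - c0)^2 <= 1, hence [t] >= [e] > 0
   everywhere. *)
pose c0 := cut_cot y0; pose ka : R := (4 * (cot_floor^-1) ^+ 2 + 1)^-1.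
have B0 := sqr_ge0 (cot_floor^-1).
have ka0 : 0 < ka by rewrite invr_gt0; lra.
(* Then t > 1 means (c - c0)^2 < (1 - eta) / 2. Off the zero set of [g], this gives cos(2 pi (y -
   y0)) = 1 - 2 sin^2(pi (y - y0)) > eta, which is where [g] is positive. *)
pose e := ka * ((1 - eta) / 2).
have e0 : 0 < e by apply: mulr_gt0 => //; lra.
pose t y := 1 + e - ka * (cut_cot y - c0) ^+ 2.
have ct : continuous t by rewrite /t; cont.
have t0 y : e <= t y.
  rewrite /t addrAC lerDr subr_ge0 mulrC ler_pdivrMr ?mul1r//; last by lra.
  have := cut_cot_bound y; have := cut_cot_bound y0; rewrite -/c0.
  rewrite !ler_norml => /andP[? ?] /andP[? ?]; nra.
pose phi y := g y * (1 + cut_cot y ^+ 2).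
apply: (@cint_peak R phi t y0) => //; rewrite ?/phi.
- by cont.
- by rewrite /t -/c0 subrr expr0n/= mulr0; lra.
- by apply: mulr_gt0 => //; rewrite ltr_pwDl// sqr_ge0.
- move=> y Dy; have ty := t0 y; have [t1|t1] := leP (t y) 1.
    by left; rewrite ger0_norm//; lra.
  right; split; first by lra.
  apply: mulr_ge0; last by rewrite addr_ge0// sqr_ge0.
  have [yd|yd] := ltP `|y| d; first by rewrite g0.
  apply/ltW/etaP.
  have [y0d|y0d] := ltP `|y0| d; first by rewrite g0// ltxx in gy0.
  have [sy cy] := cut_cotE Dy yd; have [sy0 cy0] := cut_cotE Dy0 y0d.
  have -> : 2 * pi * (y - y0) = (pi * (y - y0)) *+ 2 by rewrite -[RHS]mulr_natr; ring.
  rewrite cos_mulr2n cos2sin2.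
  have -> : sin (pi * (y - y0)) = sin (pi * y) * sin (pi * y0) * (c0 - cut_cot y).
    by rewrite mulrBr sinB cy cy0 /c0; ring.
  have H : ka * (cut_cot y - c0) ^+ 2 < e by move: t1; rewrite /t; lra.
  rewrite /e ltr_pM2l// in H.
  have : (sin (pi * y) * sin (pi * y0) * (c0 - cut_cot y)) ^+ 2 <= (cut_cot y - c0) ^+ 2.
    rewrite exprMn -(sqrrN (c0 - _)) opprB ler_piMl ?sqr_ge0//.
  by rewrite -mulr_natr; lra.
(* Quantifying over j makes this class stable under multiplication by [t], a polynomial in
   [cut_cot]. *)
move=> N; pose Z h := continuous h /\ forall j, cint (fun y => phi y * h y * cut_cot y ^+ j) = 0.
suff : Z (fun y => t y ^+ N).
  by case=> _ /(_ 0%N) <-; apply: eq_cint => y; rewrite expr0 mulr1.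
have cphi : continuous phi by rewrite /phi; cont.
elim: N => [|N [ch hZ]].
  split; first by cont.
  by move=> j; rewrite -[RHS](gm j); apply: eq_cint => y; rewrite expr0 mulr1.
split; first by cont.
move=> j; transitivity (cint (fun y => (1 + e - ka * c0 ^+ 2) * (phi y * t y ^+ N * cut_cot y ^+ j)
   + (2 * ka * c0 * (phi y * t y ^+ N * cut_cot y ^+ j.+1)
   - ka * (phi y * t y ^+ N * cut_cot y ^+ j.+2)))).
  by apply: eq_cint => y; rewrite exprS {1}/t (exprS _ j.+1) (exprS _ j); ring.
by rewrite cintD ?cintB ?cintZ ?hZ ?mulr0 ?subrr ?addr0//; cont.
Qed.

Lemma cot_moments_eq0 g : continuous g -> periodic g 1 ->
  (forall y, `|y| < d -> g y = 0) ->
  (forall j, cint (fun y => g y * (1 + cut_cot y ^+ 2) * cut_cot y ^+ j) = 0) ->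
  forall y, g y = 0.
Proof.
move=> cg pg g0 gm; apply: periodic_eq0 => // y Dy.
apply/eqP; rewrite eq_le (cot_moments_le0 cg pg g0 gm Dy)/= -oppr_le0.
have cc := cut_cot_continuous.
apply: (@cot_moments_le0 (fun y => - g y)) => //; first by cont.
- by move=> x; rewrite pg.
- by move=> x /g0 ->; rewrite oppr0.
- move=> j; rewrite -[RHS](mulr0 (-1)) -(gm j) -cintZ; last by cont.
  by apply: eq_cint => x; ring.
Qed.

End cotangent.

(** * Unique continuation for the periodic Hilbert transform *)

Section unique_continuation.
Variable R : realType.
Local Notation D := (@circle_dom R).
Local Notation wt n := (if n == 0%N then 1 else 2 : R).

(** Closed form of the kernel of the partial sums of a conjugate series, multiplied by sin al so
    that it also holds at the pole of the cotangent. *)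
Lemma conjugate_dirichlet_kernel (al : R) N :
  sin al * (\sum_(n < N.+1) wt (n : nat) * sin (2 * n%:R * al)) =
  cos al * (1 - cos (2 * N%:R * al)) + sin al * sin (2 * N%:R * al).
Proof.
elim: N => [|N ih].
  by rewrite big_ord_recr big_ord0/= mulr0 mul0r cos0 sin0; ring.
rewrite big_ord_recr/= mulrDr ih.
have -> : 2 * N.+1%:R * al = 2 * N%:R * al + al *+ 2.
  by rewrite -(mulr_natr al 2) -(natr1 N); ring.
have cs := cos2Dsin2 al.
set be := 2 * _ * al; rewrite (sinD be (al *+ 2)) (cosD be (al *+ 2)) sin_mulr2n cos_mulr2n.
rewrite -(mulr_natr (_ * _) 2) -(mulr_natr (_ ^+ 2) 2).
set c := cos al in cs *; set s := sin al in cs *.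
set cb := cos be; set sb := sin be.
apply/eqP; rewrite -subr_eq0; apply/eqP.
transitivity ((c ^+ 2 + s ^+ 2 - 1) * (2 * c * cb)).
  by ring.
by rewrite cs subrr mul0r.
Qed.

(** The slope of tan(pi x) at 0 is pi >= 2, so an error of at most |x| in the linearization leaves
    |tan(pi x)| >= (pi - 1) |x| >= |x|. *)
Lemma tan_near0 (eta : R) : 0 < eta -> exists2 r : R, 0 < r &
  forall x : R, `|x| < r -> [/\ cos (pi * x) != 0, `|tan (pi * x)| <= eta & `|x| <= `|tan (pi * x)|].
Proof.
move=> eta0; have pi0 := @pi_gt0 R; have pi2 := @pi_ge2 R.
have dt : is_derive (0 : R) (1 : R) (fun x => tan (pi * x)) pi.
  have d : is_derive (0 : R) (1 : R) (fun y => pi * y) pi.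
    by apply: is_derive_eq; rewrite /GRing.scale/= mulr1.
  have c0 : cos (pi * 0 : R) != 0 by rewrite mulr0 cos0 oner_neq0.
  apply: (@is_derive_eq _ _ _ _ _ _ _ _ (is_derive1_comp (is_derive_tan c0) d)).
  by rewrite mulr0 cos0 expr1n invr1 mul1r.
have [r r0 rP] := (is_derive_eps _ _ _).2 dt 1 ltr01.
pose b : R := eta / (pi + 1).
have b0 : 0 < b by apply: divr_gt0 => //; lra.
exists (Num.min (Num.min r b) 2^-1).
  by rewrite !lt_min r0 b0/=; lra.
move=> x; rewrite !lt_min => /andP[/andP[xr xb] x2].
have := rP x xr; rewrite add0r mulr0 tan0 subr0 mul1r => H.
have piX : `|x * pi| = pi * `|x| by rewrite normrM (gtr0_norm pi0) mulrC.
have T1 : `|tan (pi * x)| <= (pi + 1) * `|x|.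
  have := ler_normD (tan (pi * x) - x * pi) (x * pi); rewrite subrK piX; lra.
have T2 : pi * `|x| <= `|tan (pi * x)| + `|x|.
  rewrite -piX; have := ler_normD (x * pi - tan (pi * x)) (tan (pi * x)); rewrite subrK distrC; lra.
split.
- rewrite gt_eqF// cos_gt0_pihalf//; move: x2; rewrite ltr_norml => /andP[x3 x4].
  by rewrite -mulrN !ltr_pM2l// x3.
- apply: le_trans T1 _; rewrite -ler_pdivlMl; last by lra.
  by rewrite mulrC; exact: ltW.
- have := normr_ge0 x; nra.
Qed.

Variable d : R.
Hypotheses (d0 : 0 < d) (d1 : d <= 2^-1).
Variables g w : R -> R.
Hypotheses (cg : continuous g) (pg : periodic g 1)
  (g0 : forall y, `|y| < d -> g y = 0).
Hypothesis w_series : ucv (trig_sum (fcos w) (fsin w)) w.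
(** Real and imaginary parts of multiplication by -i, as a Fourier coefficient is [fcos] - i [fsin]:
    [w] is the Hilbert transform of [g]. *)
Hypotheses (fcos_w0 : fcos w 0 = 0)
  (fcos_w : forall n, (0 < n)%N -> fcos w n = - fsin g n)
  (fsin_w : forall n, (0 < n)%N -> fsin w n = fcos g n).
(** Vanishing to infinite order in a weak form that integral bounds yield and that a nonzero leading
    term contradicts. *)
Hypothesis w_flat : forall k m, 0 < m ->
  ~ exists2 r : R, 0 < r & forall x, `|x| < r -> m * `|x| ^+ k <= `|w x|.

Local Notation c := (cut_cot d).
Local Notation B := (cot_floor d)^-1.

(* By the addition formula this is [cot (pi * (x - y))], written in terms of [tan (pi * x)] and [cot (pi * y)]. *)
Definition cot_kernel (tau y : R) : R := - (c y + tau) / (1 - tau * c y).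

Lemma cut_cot_small tau y : `|tau| * B <= 2^-1 -> `|tau * c y| <= 2^-1.
Proof.
move=> h; apply: le_trans h; rewrite normrM ler_wpM2l//.
exact: cut_cot_bound.
Qed.

Lemma cot_kernel_den tau y : `|tau| * B <= 2^-1 -> 2^-1 <= 1 - tau * c y.
Proof. by move=> /(@cut_cot_small _ y); rewrite ler_norml; lra. Qed.

Lemma cot_kernel_continuous tau : `|tau| * B <= 2^-1 -> continuous (cot_kernel tau).
Proof.
move=> h; have cc := cut_cot_continuous d0 d1; apply: contM; first by cont.
apply: contV => [|y]; first by cont.
by have h2 := cot_kernel_den y h; rewrite gt_eqF//; lra.
Qed.

Lemma trig_sum_kernel x N :
  trig_sum (fcos w) (fsin w) N x =
  cint (fun y => g y * \sum_(n < N) wt (n : nat) * sin (2 * n%:R * (pi * (x - y)))).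
Proof.
transitivity (cint (fun y => \sum_(n < N) (wt (n : nat) * (g y * sin (2 * n%:R * (pi * (x - y))))))).
  rewrite (@cint_sum _ N (fun n y => wt n * (g y * sin (2 * n%:R * (pi * (x - y)))))); last first.
    by move=> i; cont.
  apply: eq_bigr => n _; rewrite cintZ; last by cont.
  rewrite /trig_term; congr (_ * _).
  transitivity (- fsin g n * cos (2 * pi * n%:R * x) + fcos g n * sin (2 * pi * n%:R * x)).
    case: n => -[|n] nN /=; last by rewrite fcos_w// fsin_w.
    by rewrite fcos_w0 !fsin0 oppr0 !(mulr0, mul0r) sin0 !mulr0.
  transitivity (cint (fun y => - cos (2 * pi * n%:R * x) * (g y * sin (2 * pi * n%:R * y))
     + sin (2 * pi * n%:R * x) * (g y * cos (2 * pi * n%:R * y)))).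
    by rewrite cintD ?cintZ; [rewrite /fsin /fcos; ring|cont|cont|cont|cont].
  apply: eq_cint => y.
  have -> : 2 * n%:R * (pi * (x - y)) = 2 * pi * n%:R * x - 2 * pi * n%:R * y by ring.
  by rewrite sinB; ring.
apply: eq_cint => y; rewrite mulr_sumr; apply: eq_bigr => n _; ring.
Qed.

(** Either [g y] = 0, or |y| >= d and [cut_cot] is the true cotangent; then sin(pi (x - y)) is
    nonzero, because the denominator of [cot_kernel] is, and the closed form may be divided by
    it. *)
Lemma kernel_identity x y N : cos (pi * x) != 0 -> `|tan (pi * x)| * B <= 2^-1 -> D y ->
  g y * (\sum_(n < N.+1) wt (n : nat) * sin (2 * n%:R * (pi * (x - y)))) =
  g y * (cot_kernel (tan (pi * x)) y * (1 - cos (2 * N%:R * (pi * (x - y)))) +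
         sin (2 * N%:R * (pi * (x - y)))).
Proof.
move=> cx tB Dy; have [yd|yd] := ltP `|y| d; first by rewrite g0// !mul0r.
congr (_ * _); have [sy cy] := cut_cotE d0 d1 Dy yd.
have := conjugate_dirichlet_kernel (pi * (x - y)) N.
have den := cot_kernel_den y tB.
have den0 : 1 - tan (pi * x) * c y != 0 by rewrite gt_eqF//; lra.
set S := \sum_(_ < _) _; set al := pi * (x - y).
set tau := tan (pi * x) in den den0 *.
have sx : sin (pi * x) = tau * cos (pi * x) by rewrite /tau /tan divfK.
have sal : sin al = - cos (pi * x) * sin (pi * y) * (1 - tau * c y).
  by rewrite /al mulrBr sinB cy sx; ring.
have cal : cos al = cos (pi * x) * sin (pi * y) * (c y + tau).
  by rewrite /al mulrBr cosB cy sx; ring.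
have sal0 : sin al != 0 by rewrite sal !mulf_neq0// oppr_eq0.
move=> H; apply: (mulfI sal0); rewrite H [RHS]mulrDr; congr (_ + _).
rewrite [RHS]mulrA; congr (_ * _). rewrite sal cal /cot_kernel -/tau; field.
exact: den0.
Qed.

(** The oscillating parts of the closed form are Fourier coefficients of the continuous functions
    [k] and [g], so they tend to 0 by Riemann-Lebesgue. *)
Lemma conjugate_integral x : cos (pi * x) != 0 -> `|tan (pi * x)| * B <= 2^-1 ->
  w x = cint (fun y => g y * cot_kernel (tan (pi * x)) y).
Proof.
move=> cx tB; set tau := tan (pi * x) in tB *.
have ck := cot_kernel_continuous tB.
pose k y := g y * cot_kernel tau y.
have ck' : continuous k by rewrite /k; cont.
have E N : trig_sum (fcos w) (fsin w) N.+1 x = cint k -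
   (cos (2 * pi * N%:R * x) * fcos k N + sin (2 * pi * N%:R * x) * fsin k N) +
   (sin (2 * pi * N%:R * x) * fcos g N - cos (2 * pi * N%:R * x) * fsin g N).
  rewrite trig_sum_kernel /fcos /fsin -!cintZ; try by cont.
  rewrite -cintD; try by cont.
  rewrite -cintB; try by cont.
  rewrite -cintB; try by cont.
  rewrite -cintD; try by cont.
  apply: eq_Rintegral => y /set_mem Dy; rewrite (kernel_identity _ cx tB Dy) -/tau.
  have -> : 2 * N%:R * (pi * (x - y)) = 2 * pi * N%:R * x - 2 * pi * N%:R * y by ring.
  by rewrite cosB sinB /k; ring.
apply/eqP; rewrite -subr_eq0 -normr_le0; apply/ler_addgt0Pr => e e0; rewrite add0r.
(* Five errors: one from the Fourier series of [w], two from coefficients of [k] and two from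
   coefficients of [g]. *)
have e50 : 0 < e / 5 by lra.
have [N1 P1] := riemann_lebesgue ck' e50.
have [N2 P2] := riemann_lebesgue cg e50.
have [N3 P3] := w_series e50.
pose N := maxn N3 (maxn N1 N2).
have [p1 p2] := P1 N (leq_trans (leq_maxl N1 N2) (leq_maxr _ _)).
have [p3 p4] := P2 N (leq_trans (leq_maxr N1 N2) (leq_maxr _ _)).
have := P3 N.+1 (leqW (leq_maxl _ _)) x; rewrite E.
have lec (a b : R) : `|a| <= 1 -> `|b| <= e / 5 -> `|a * b| <= e / 5.
  by move=> a1 be; rewrite normrM -[_ / _]mul1r ler_pM.
have := lec _ _ (cos_max (2 * pi * N%:R * x)) p1.
have := lec _ _ (sin_max (2 * pi * N%:R * x)) p2.
have := lec _ _ (sin_max (2 * pi * N%:R * x)) p3.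
have := lec _ _ (cos_max (2 * pi * N%:R * x)) p4.
rewrite -/(cint _) -/k !ler_norml; lra.
Qed.

Definition cot_moment (k : nat) : R :=
  if k is j.+1 then cint (fun y => g y * (1 + c y ^+ 2) * c y ^+ j)
  else cint (fun y => g y * c y).

Definition cot_remainder (k : nat) (tau : R) : R :=
  cint (fun y => g y * (1 + c y ^+ 2) * c y ^+ k * (1 - tau * c y)^-1).

Lemma remainder_continuous k tau : `|tau| * B <= 2^-1 ->
  continuous (fun y => g y * (1 + c y ^+ 2) * c y ^+ k * (1 - tau * c y)^-1).
Proof.
move=> h; have cc := cut_cot_continuous d0 d1; apply: contM; first by cont.
apply: contV => [|y]; first by cont.
by have h2 := cot_kernel_den y h; rewrite gt_eqF//; lra.
Qed.

(** Start from (c + tau) / (1 - tau c) = c + tau (1 + c^2) / (1 - tau c), then apply 1 / (1 - tau c)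
    = 1 + tau c / (1 - tau c) repeatedly. *)
Lemma kernel_expansion k tau : `|tau| * B <= 2^-1 ->
  cint (fun y => g y * cot_kernel tau y) =
  - (\sum_(j < k.+1) tau ^+ j * cot_moment j) - tau ^+ k.+1 * cot_remainder k tau.
Proof.
move=> tB; have cc := cut_cot_continuous d0 d1.
have den y : 1 - tau * c y != 0 by have h2 := cot_kernel_den y tB; rewrite gt_eqF//; lra.
have cr j := @remainder_continuous j tau tB.
elim: k => [|k ->].
  rewrite big_ord_recr big_ord0/= expr0 mul1r add0r expr1 /cot_remainder -cintZ//.
  transitivity (cint (fun y => -1 * (g y * c y) -
       tau * (g y * (1 + c y ^+ 2) * c y ^+ 0 * (1 - tau * c y)^-1))).
    by apply: eq_cint => y; rewrite /cot_kernel expr0; field.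
  rewrite cintB ?cintZ ?mulN1r//; try by cont.
  by apply: contM; [cont|exact: cr].
rewrite [in RHS]big_ord_recr/= opprD -addrA; congr (_ + _).
rewrite -opprD [tau ^+ k.+2]exprSr -mulrA -mulrDr; congr (- (_ * _)).
rewrite /cot_remainder -cintZ// -cintD; first last.
- by apply: contM; [cont|exact: cr].
- by cont.
by apply: eq_cint => y; rewrite [c y ^+ k.+1]exprS; field.
Qed.

Lemma remainder_bound k : exists2 L, 0 < L & forall tau, `|tau| * B <= 2^-1 ->
  `|cot_remainder k tau| <= L.
Proof.
have cc := cut_cot_continuous d0 d1.
have [|M M0 MP] := @circle_bounded R (fun y => g y * (1 + c y ^+ 2) * c y ^+ k).
  by cont.
exists (2 * M + 1); first by lra.
move=> tau tB; apply: cint_norm_le; first exact: remainder_continuous.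
move=> y Dy; rewrite normrM; have den := cot_kernel_den y tB.
apply: (@le_trans _ _ (M * 2)); last by lra.
apply: ler_pM => //; first exact: MP.
rewrite gtr0_norm ?invr_gt0; last by lra.
by rewrite -[X in _ <= X]invrK lef_pV2 ?posrE//; lra.
Qed.

(** By strong induction: if the earlier moments vanish and this one does not, its term leads the
    expansion of [w], which is then bounded below by a multiple of |tan(pi x)|^k >= |x|^k. *)
Lemma cot_moment_eq0 k : cot_moment k = 0.
Proof.
have [n] := ubnP k; elim: n k => // n ih k kn.
apply/eqP; apply/negPn/negP => mk.
have m0 : 0 < `|cot_moment k| by rewrite normr_gt0.
have [L L0 LP] := remainder_bound k.
have B0 : 0 < B by rewrite invr_gt0 cot_floor_gt0.
apply: (@w_flat k (`|cot_moment k| / 2)); first by lra.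
(* The first bound makes the expansion valid; the second makes the remainder at most half of the
   leading term. *)
pose eta := Num.min (2^-1 / B) (`|cot_moment k| / 2 / L).
have eta0 : 0 < eta by rewrite lt_min !divr_gt0//; lra.
have [r r0 rP] := tan_near0 eta0; exists r => // x /rP[cx].
rewrite le_min => /andP[]; rewrite !ler_pdivlMr// => tB tL xt.
rewrite (conjugate_integral cx tB) (kernel_expansion k tB) big_ord_recr/= big1 ?add0r; last first.
  by move=> i _; rewrite ih ?mulr0//; apply: leq_trans (ltn_ord i) _.
set tau := tan (pi * x) in tB tL xt *.
rewrite exprSr -mulrA -opprD normrN -mulrDr normrM normrX [X in X <= _]mulrC.
apply: ler_pM => //.
- by rewrite lerXn2r ?nnegrE.
have : `|tau * cot_remainder k tau| <= `|cot_moment k| / 2.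
  apply: (@le_trans _ _ (`|tau| * L)); last by lra.
  by rewrite normrM ler_wpM2l// LP.
have := ler_normB (cot_moment k + tau * cot_remainder k tau) (tau * cot_remainder k tau).
rewrite addrK; lra.
Qed.

Lemma unique_continuation y : g y = 0.
Proof.
apply: (cot_moments_eq0 d0 d1 cg pg g0) => j.
exact: (cot_moment_eq0 j.+1).
Qed.

End unique_continuation.

(** * From integral flatness to the failure of pointwise lower bounds *)

Section flatness.
Variable R : realType.
Local Notation mu := (@lebesgue_measure R).

(** A lower bound m |x|^k on [r/2, r] gives an integral of at least a r^(2k+1), which contradicts
    the flatness exponent 2k + 2 for small r. *)
Lemma flat_no_lower_bound (W : R -> R) : continuous W ->
  (forall N : nat, (0 < N)%N -> exists c : R, \forall r \near (0 : R)^'+,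
     (\int[mu]_(x in [set x : R | (`|x| <= r)%R]) (`|W x| ^+ 2)%:E <= (c * r ^+ N)%:E)%E) ->
  forall k m, 0 < m -> ~ exists2 r : R, 0 < r & forall x, `|x| < r -> m * `|x| ^+ k <= `|W x|.
Proof.
move=> cW flat k m m0 [r0 r00 low].
have [c] := flat (k.+1.*2) isT.
pose a : R := (m / 2 ^+ k) ^+ 2 / 2.
have a0 : 0 < a by rewrite divr_gt0// exprn_gt0// divr_gt0// exprn_gt0.
(* For 0 < r < b one has c r < a, so c r^(2k+2) < a r^(2k+1). *)
pose b := a / (`|c| + 1).
have c0 := normr_ge0 c.
have b0 : 0 < b by apply: divr_gt0 => //; lra.
have n1 : \forall r \near (0 : R)^'+, r < r0 by exact: nbhs_right_lt.
have n2 : \forall r \near (0 : R)^'+, r < b by exact: nbhs_right_lt.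
have n3 : \forall r \near (0 : R)^'+, 0 < r by exact: nbhs_right_gt.
move=> n4; have [r [[r1 r2] [r3 r4]]] := filter_ex (filterI (filterI n1 n2) (filterI n3 n4)).
have mW : measurable_fun setT (fun x => `|W x| ^+ 2).
  by apply: continuous_measurable_fun; cont.
have mS : measurable [set x : R | (`|x| <= r)%R].
  rewrite (_ : [set x : R | (`|x| <= r)%R] = `[- r, r]%classic); first exact: measurable_itv.
  by apply/seteqP; split=> x /=; rewrite in_itv/= ler_norml.
have : (((m * (r / 2) ^+ k) ^+ 2)%:E * mu `[(r / 2)%R, r]%classic <= (c * r ^+ k.+1.*2)%:E)%E.
  apply: le_trans r4; rewrite -integral_cst//.
  apply: (@le_trans _ _ (\int[mu]_(x in `[(r / 2)%R, r]%classic) (`|W x| ^+ 2)%:E)%E).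
    apply: ge0_le_integral => //.
    - by move=> x _; rewrite lee_fin sqr_ge0.
    - by apply/measurable_EFinP; apply: measurable_funTS.
    - move=> x /=; rewrite in_itv/= => /andP[x1 x2]; rewrite lee_fin lerXn2r ?nnegrE//.
        by rewrite mulr_ge0 ?exprn_ge0//; lra.
      have x0 : 0 <= x by lra.
      apply: le_trans (low x _); last by rewrite ger0_norm//; lra.
      rewrite ler_pM2l// lerXn2r ?nnegrE//; last by rewrite ger0_norm.
      by lra.
  apply: ge0_subset_integral => //.
  - by apply/measurable_EFinP; apply: measurable_funTS.
  - by move=> x /=; rewrite in_itv/= ler_norml => /andP[? ?]; apply/andP; split; lra.
rewrite lebesgue_measure_itv/= lte_fin ifT; last by lra.
rewrite -EFinD -EFinM lee_fin; apply/negP; rewrite -ltNge.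
have E1 : (m * (r / 2) ^+ k) ^+ 2 * (r - r / 2) = a * (r ^+ k * r ^+ k * r).
  by rewrite /a (expr_div_n r 2 k); field; rewrite expf_neq0// pnatr_eq0.
have E2 : c * r ^+ k.+1.*2 = (c * r) * (r ^+ k * r ^+ k * r).
  by rewrite doubleS -addnn !exprS exprD; ring.
rewrite E1 E2 ltr_pM2r; last by rewrite !mulr_gt0// exprn_gt0.
apply: (@le_lt_trans _ _ ((`|c| + 1) * r)).
  by rewrite ler_pM2r//; have := ler_norm c; lra.
by rewrite mulrC -ltr_pdivlMr//; lra.
Qed.

End flatness.

(** * Regularity of a solution at a fixed time *)

Section solution.
Variable R : realType.
Implicit Types (f g : R -> R) (u : R -> R -> R).
Local Notation D := (@circle_dom R).

Lemma derive_unique f (a b x : R) :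
  is_derive x (1 : R) f a -> is_derive x (1 : R) f b -> a = b.
Proof. by move=> [_ <-] [_ <-]. Qed.

Lemma derive1_eq f df : (forall x : R, is_derive x (1 : R) f (df x)) -> f^`()%classic = df.
Proof. by move=> fdf; apply/funext => x; rewrite derive1E; case: (fdf x). Qed.

Lemma smooth_C2 f : smooth f -> exists f1 f2, [/\ forall x : R, is_derive x (1 : R) f (f1 x),
  forall x : R, is_derive x (1 : R) f1 (f2 x) & continuous f2].
Proof.
move=> sf; exists (f^`(1))%classic, (f^`(2))%classic.
have H n (x : R) : is_derive x (1 : R) (f^`(n))%classic ((f^`(n.+1))%classic x).
  by rewrite derive1nS derive1E; apply/derivableP/sf.
split; [exact: (H 0%N)|exact: H|].
exact: is_derive_continuous (H 2).
Qed.

Lemma is_derive_compR f g (a b x : R) : is_derive (g x) (1 : R) f a ->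
  is_derive x (1 : R) g b -> is_derive x (1 : R) (fun y => f (g y)) (a * b).
Proof. by move=> df dg; exact: is_derive1_comp. Qed.

Lemma hilbert_transform_coefs g h : is_hilbert_transform g h ->
  [/\ fcos h 0 = 0, forall n, (0 < n)%N -> fcos h n = - fsin g n &
     forall n, (0 < n)%N -> fsin h n = fcos g n].
Proof.
move=> [_ _ H].
have E k n : fourier_coef k (Posz n) = Complex (fcos k n) (- fsin k n) by [].
split.
- have := H 0; rewrite E sgz0 mulr0 mul0r => -[] //.
- case=> // n _; have := H n.+1%:Z; rewrite !E gtr0_sgz// mulr1 /= => -[] + _ => ->.
  by rewrite !(mul0r, oppr0, mulNr, mulrN, add0r, sub0r, mul1r, opprK).
- case=> // n _; have := H n.+1%:Z; rewrite !E gtr0_sgz// mulr1 /= => -[] _.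
  move=> e; apply: oppr_inj; rewrite e.
  by rewrite !(mul0r, oppr0, mulNr, mulrN, add0r, addr0, mul1r).
Qed.

(* [v1] and [v2] are the space derivatives of [u t], and [w] is the Hilbert transform of [v2]. *)
Record solution_slice (T : R) f1 u (t : R) (v1 v2 w : R -> R) (K : R) : Prop := SolutionSlice {
  slice_cont : continuous (u t);
  slice_periodic : periodic (u t) 1;
  slice_d1 : forall x : R, is_derive x (1 : R) (u t) (v1 x);
  slice_d2 : forall x : R, is_derive x (1 : R) v1 (v2 x);
  slice_v2_cont : continuous v2;
  slice_v2_periodic : periodic v2 1;
  slice_v2_cos : forall n, fcos v2 n = - (2 * pi * n%:R) ^+ 2 * fcos (u t) n;
  slice_v2_sin : forall n, fsin v2 n = - (2 * pi * n%:R) ^+ 2 * fsin (u t) n;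
  slice_sum : forall M, \sum_(n < M) (`|fcos (u t) n| + `|fsin (u t) n|) <= K;
  slice_v2_sum : forall M, \sum_(n < M) (`|fcos v2 n| + `|fsin v2 n|) <= K;
  slice_w_cont : continuous w;
  slice_w_periodic : periodic w 1;
  slice_w0 : fcos w 0 = 0;
  slice_w_cos : forall n, (0 < n)%N -> fcos w n = - fsin v2 n;
  slice_w_sin : forall n, (0 < n)%N -> fsin w n = fcos v2 n;
  slice_cvg : forall x, cvg (dt_quotient T u t x);
  slice_dt : forall x, dt T u t x = w x - f1 (u t x) * v1 x }.

Lemma sobolev_finite (r : R) g : in_sobolev r g -> exists2 d, 0 < d & (sobolev_norm r g < d%:E)%E.
Proof.
move=> [_]; have : (0 <= sobolev_norm r g)%E by exact: poweR_ge0.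
case: (sobolev_norm r g) => [x||] //; rewrite lee_fin => x0 _.
by exists (x + 1); rewrite ?lte_fin; lra.
Qed.

Lemma solution_sliceP (T s : R) f f1 u t : 5 / 2 < s ->
  (forall x : R, is_derive x (1 : R) f (f1 x)) -> gBO_solution T s f u -> `[0, T]%classic t ->
  exists v1 v2 w K, solution_slice T f1 u t v1 v2 w K.
Proof.
move=> s52 df [Cu _ cu Hu] tT.
have [C C0 CP] := sobolev_weighted_l1 s52.
have [ut _] := Cu t tT; have [[pu _ _] _] := ut.
have [d d0 dP] := sobolev_finite ut.
have [v1 [v2 [dv1 dv2 cv2 pv2 [c2 s2 _ _ [K2 K2P]]]]] := fourier_C2 (cu t tT) pu (CP _ _ d0 dP).
have [w [cw Hw eqn]] := Hu t tT.
rewrite derive1nS derive1n1 (derive1_eq dv1) (derive1_eq dv2) in Hw.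
have [w0 wc ws] := hilbert_transform_coefs Hw.
case: Hw => _ [pw _ _] _.
exists v1, v2, w, (`|C * d| + `|K2|); split => //.
- exact: cu.
- move=> M; apply: (@le_trans _ _ (C * d)); last first.
    by have := ler_norm (C * d); have := normr_ge0 K2; lra.
  apply: le_trans (CP _ _ d0 dP M); apply: ler_sum => n _.
  by rewrite ler_peMl ?addr_ge0// lerDl sqr_ge0.
- move=> M; apply: le_trans (K2P M) _.
  by have := ler_norm K2; have := normr_ge0 (C * d); lra.
- by move=> x; case: (eqn x).
- move=> x; have [_] := eqn x.
  rewrite derive1E (_ : 'D_1 _ x = f1 (u t x) * v1 x); first lra.
  by case: (is_derive_compR (df (u t x)) (dv1 x)).
Qed.

Lemma fcosB f g n : continuous f -> continuous g ->
  fcos (fun x => f x - g x) n = fcos f n - fcos g n.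
Proof. by move=> cf cg; rewrite /fcos -cintB; try cont; apply: eq_cint => x; rewrite mulrBl. Qed.

Lemma fsinB f g n : continuous f -> continuous g ->
  fsin (fun x => f x - g x) n = fsin f n - fsin g n.
Proof. by move=> cf cg; rewrite /fsin -cintB; try cont; apply: eq_cint => x; rewrite mulrBl. Qed.

Lemma fourier_sum_le f g K1 K2 : continuous f -> continuous g ->
  (forall M, \sum_(n < M) (`|fcos f n| + `|fsin f n|) <= K1) ->
  (forall M, \sum_(n < M) (`|fcos g n| + `|fsin g n|) <= K2) ->
  forall M, \sum_(n < M) (`|fcos (fun x => (f x - g x)%R) n| + `|fsin (fun x => (f x - g x)%R) n|) <= K1 + K2.
Proof.
move=> cf cg fK gK M; apply: le_trans (lerD (fK M) (gK M)); rewrite -big_split/=.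
apply: ler_sum => n _; rewrite fcosB// fsinB//.
have := ler_normB (fcos f n) (fcos g n); have := ler_normB (fsin f n) (fsin g n); lra.
Qed.

End solution.

(** * Uniform convergence of the difference quotients in time *)

Section time_derivative.
Variable R : realType.
Implicit Types (f g v : R -> R) (u : R -> R -> R).
Local Notation mu := (@lebesgue_measure R).
Local Notation D := (@circle_dom R).

Lemma ereal_cvg0_lt (I : Type) (F : set_system I) {FF : Filter F} (k : I -> \bar R) (d : R) :
  0 < d -> k i @[i --> F] --> 0%E -> \forall i \near F, (k i < d%:E)%E.
Proof. by move=> d0 H; exact: (H _ (@nbhs_open_ereal_lt R 0 (fun=> d) d0)). Qed.

Lemma circle_L2_integrableM g h : circle_L2 g -> continuous h ->
  mu.-integrable D (EFin \o (fun x => g x * h x)).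
Proof.
move=> [_ mg ig] ch; have ch2 : continuous (fun x => h x ^+ 2) by cont.
have ih := circle_integrable ch2.
apply: (le_integrable _ _ _ (integrableD _ ig ih)) => //=; try exact: circle_measurable.
- apply/measurable_EFinP; apply: measurable_funM.
    exact: measurable_funTS.
  by apply: measurable_funTS; exact: continuous_measurable_fun.
- move=> x _; rewrite lee_fin [X in _ <= X]ger0_norm ?addr_ge0 ?sqr_ge0//.
  rewrite ler_norml; have := sqr_ge0 (g x + h x); have := sqr_ge0 (g x - h x).
  by have := sqr_ge0 (g x); have := sqr_ge0 (h x); rewrite !expr2; lra.
Qed.

(** [v] is only square integrable: it cancels once the integrals containing it are split, which
    requires [v h] to be integrable. *)
Lemma cintB_L2 g1 g2 v h : continuous g1 -> continuous g2 -> circle_L2 v -> continuous h ->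
  cint (fun x => (g1 x - g2 x) * h x) =
  cint (fun x => (g1 x - v x) * h x) - cint (fun x => (g2 x - v x) * h x).
Proof.
move=> cg1 cg2 Lv ch; have iv := circle_L2_integrableM Lv ch.
have E g : continuous g -> cint (fun x => (g x - v x) * h x) =
    cint (fun x => g x * h x) - cint (fun x => v x * h x).
  move=> cg; have cgh : continuous (fun x => g x * h x) by cont.
  rewrite /cint -RintegralB//; [|exact: circle_measurable|exact: circle_integrable].
  by apply: eq_Rintegral => x _; rewrite mulrBl.
rewrite !E// opprB addrA subrK -cintB; try by cont.
by apply: eq_cint => x; rewrite mulrBl.
Qed.

(* The time derivative [v] in the Sobolev space need not be a continuous representative,
   so difference quotients are compared with each other rather than with [v]. *)
Lemma sobolev_close_uniform (r : R) : 2^-1 < r -> exists2 C, 0 < C &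
  forall g1 g2 v (d : R), 0 < d ->
    continuous g1 -> periodic g1 1 -> continuous g2 -> periodic g2 1 -> circle_L2 v ->
    (sobolev_norm r (fun x => (g1 x - v x)%R) < d%:E)%E ->
    (sobolev_norm r (fun x => (g2 x - v x)%R) < d%:E)%E ->
    forall x, `|g1 x - g2 x| <= C * d.
Proof.
move=> r2; have [C C0 CP] := sobolev_l1 r2; exists (4 * C); first by lra.
move=> g1 g2 v d d0 cg1 pg1 cg2 pg2 Lv n1 n2 x.
pose g x := g1 x - g2 x.
have cg : continuous g by rewrite /g; cont.
have pg : periodic g 1 by move=> y; rewrite /g pg1 pg2.
have K M : \sum_(n < M) (`|fcos g n| + `|fsin g n|) <= 2 * C * d.
  apply: le_trans (_ : _ <= \sum_(n < M) (`|fcos (fun x => g1 x - v x) n| + `|fsin (fun x => g1 x - v x) n|)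
    + \sum_(n < M) (`|fcos (fun x => g2 x - v x) n| + `|fsin (fun x => g2 x - v x) n|)) _; last first.
    by have := CP _ _ d0 n1 M; have := CP _ _ d0 n2 M; lra.
  rewrite -big_split/=; apply: ler_sum => n _.
  rewrite /fcos /fsin (cintB_L2 cg1 cg2 Lv); last by cont.
  rewrite (cintB_L2 cg1 cg2 Lv (h := fun x => sin (2 * pi * n%:R * x))); last by cont.
  set a := cint _; set b := cint _; set a' := cint _; set b' := cint _.
  by have := ler_normB a b; have := ler_normB a' b'; lra.
have := ucv_bound (trig_sum_le K) (fourier_series_ucv cg pg K) x; rewrite /g; lra.
Qed.

(** Nearness in H^(s-2) to the abstract derivative makes two quotients uniformly close to each
    other; the pointwise limit of one of them then identifies the derivative. *)
Lemma uniform_time_derivative (T s : R) f u t : 5 / 2 < s -> gBO_solution T s f u ->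
  0 < t < T -> forall e, 0 < e ->
  \forall h \near (0 : R)^', forall x, `|h^-1 * (u (t + h) x - u t x) - dt T u t x| <= e.
Proof.
move=> s52 [Cu [_ [v Cv vP]] cu Hu] /andP[t0 tT] e e0.
have [|C C0 CP] := @sobolev_close_uniform (s - 2); first by lra.
have tI : `]0, T[%classic t by rewrite /= in_itv/= t0.
have tI' : `[0, T]%classic t by rewrite /= in_itv/= !ltW.
have [[Lv _] _] := Cv t tI.
pose d := e / 2 / C; have d0 : 0 < d by rewrite !divr_gt0.
pose q h x := h^-1 * (u (t + h) x - u t x).
have near1 : \forall h \near (0 : R)^', (sobolev_norm (s - 2) (fun x => (q h x - v t x)%R) < d%:E)%E.
  exact: (ereal_cvg0_lt d0 (vP t tI)).
have near2 : \forall h \near (0 : R)^', `[0, T]%classic (t + h).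
  have m0 : 0 < Num.min t (T - t) by rewrite lt_min t0 subr_gt0.
  have : \forall h \near (0 : R)^', `|h| < Num.min t (T - t) by exact: dnbhs0_lt.
  apply: filterS => h; rewrite lt_min !ltr_norml /= in_itv/=.
  by move=> /andP[/andP[? ?] /andP[? ?]]; apply/andP; split; lra.
have per a : `[0, T]%classic a -> periodic (u a) 1 by move=> /Cu[[[]]].
have cq h : `[0, T]%classic (t + h) -> continuous (q h).
  by move=> /cu c1; have c2 := cu t tI'; rewrite /q; cont.
have pq h : `[0, T]%classic (t + h) -> periodic (q h) 1.
  by move=> /per p1 x; rewrite /q p1 per.
have [w [_ _ wP]] := Hu t tI'.
near=> h => x; apply/ler_addgt0Pr => eta eta0.
have [cx _] := wP x.
have /cvgrPdist_le/(_ eta eta0) : dt_quotient T u t x --> dt T u t x by [].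
rewrite near_withinE => near3.
(* [h'] may depend on x and [eta], while the condition on [h] does not; this is what makes the
   estimate uniform in x. *)
have [h' [[n1 n2] n3]] := filter_ex (filterI (filterI near1 near2) near3).
have hI : `[0, T]%classic (t + h) by near: h.
have hN : (sobolev_norm (s - 2) (fun x => (q h x - v t x)%R) < d%:E)%E by near: h.
have := CP _ _ _ d d0 (cq h hI) (pq h hI) (cq h' n2) (pq h' n2) Lv hN n1 x.
have -> : C * d = e / 2 by rewrite /d; field; rewrite gt_eqF.
have := n3 n2; rewrite -/(q h' x) -/(q h x) !ler_norml; lra.
Unshelve. all: by end_near. Qed.

End time_derivative.

(** * Equality of the two solutions at time 0 *)

Section initial_time.
Variable R : realType.
Implicit Types (f g v w : R -> R).

Lemma periodicB f g : periodic f 1 -> periodic g 1 -> periodic (fun x => f x - g x) 1.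
Proof. by move=> pf pg x; rewrite pf pg. Qed.

Lemma is_derive_locally_eq f g (df dg : R -> R) (d : R) :
  (forall x : R, is_derive x (1 : R) f (df x)) -> (forall x : R, is_derive x (1 : R) g (dg x)) ->
  (forall x, `|x| < d -> f x = g x) -> forall x, `|x| < d -> df x = dg x.
Proof.
move=> fdf gdg fg x xd; have H : is_derive x (1 : R) f (dg x).
  apply/is_derive_eps => e e0; have [d' d'0 dP] := (is_derive_eps _ _ _).2 (gdg x) e e0.
  exists (Num.min d' (d - `|x|)); first by rewrite lt_min d'0 subr_gt0.
  move=> h; rewrite lt_min => /andP[h1 h2]; rewrite !fg//; first exact: dP.
  by apply: le_lt_trans (ler_normD _ _) _; lra.
exact: derive_unique (fdf x) H.
Qed.

(** Such a function is affine, and periodicity makes its slope 0. *)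
Lemma second_derive0_periodic f (f1 f2 : R -> R) : periodic f 1 ->
  (forall x : R, is_derive x (1 : R) f (f1 x)) -> (forall x : R, is_derive x (1 : R) f1 (f2 x)) ->
  (forall x, f2 x = 0) -> forall x y, f x = f y.
Proof.
move=> pf d1 d2 f20.
have cst g (dg : R -> R) : (forall x : R, is_derive x (1 : R) g (dg x)) ->
    (forall x, dg x = 0) -> forall x y, g x = g y.
  move=> gdg dg0 x y; apply/eqP; rewrite -subr_eq0 -normr_le0.
  have := @mean_value_le R g dg 0 gdg (fun z => _) y x.
  by rewrite mul0r; apply => z; rewrite dg0 normr0.
have f1c := cst _ _ d2 f20.
have d3 (x : R) : is_derive x (1 : R) (fun y => f y - f1 0 * y) (f1 x - f1 0).
  have d := d1 x; apply: is_derive_eq.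
  by rewrite /GRing.scale/= mulr1.
have E :=  cst _ _ d3 (fun x => _).
have f10 : f1 0 = 0.
  have : f 1 - f1 0 * 1 = f 0 - f1 0 * 0 by apply: E => x; rewrite (f1c x 0) subrr.
  by rewrite -[in f 1](add0r 1) pf; lra.
by apply: cst d1 _ => x; rewrite (f1c x 0).
Qed.

Lemma initial_data_eq (T s : R) f (u1 u2 : R -> R -> R) (d : R) : 0 < T -> 5 / 2 < s ->
  smooth f -> gBO_solution T s f u1 -> gBO_solution T s f u2 -> 0 < d ->
  (forall x, `|x| < d -> u1 0 x = u2 0 x) ->
  (forall N : nat, (0 < N)%N -> exists c : R,
       \forall r \near (0 : R)^'+,
         (\int[@lebesgue_measure R]_(x in [set x : R | (`|x| <= r)%R])
            (`|dt T u1 0 x - dt T u2 0 x| ^+ 2)%:E <= (c * r ^+ N)%:E)%E) ->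
  forall x, u1 0 x = u2 0 x.
Proof.
move=> T0 s52 sf sol1 sol2 d0' ueq flat.
have [f1 [f2 [df1 df2 _]]] := smooth_C2 sf.
have tT : `[0, T]%classic (0 : R) by rewrite /= in_itv/= lexx ltW.
have [v1 [v2 [w [K S]]]] := solution_sliceP s52 df1 sol1 tT.
have [z1 [z2 [y [L Q]]]] := solution_sliceP s52 df1 sol2 tT.
pose e := Num.min d 2^-1.
have e0 : 0 < e by rewrite lt_min d0'; lra.
have e2 : e <= 2^-1 by rewrite ge_min lexx orbT.
have ueq' x : `|x| < e -> u1 0 x = u2 0 x.
  by move=> xe; apply: ueq; apply: lt_le_trans xe _; rewrite ge_min lexx.
have veq := is_derive_locally_eq (slice_d1 S) (slice_d1 Q) ueq'.
have v2eq := is_derive_locally_eq (slice_d2 S) (slice_d2 Q) veq.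
pose g x := v2 x - z2 x; pose h x := w x - y x.
have [cv2 cz2 cw cy] := And4 (slice_v2_cont S) (slice_v2_cont Q) (slice_w_cont S) (slice_w_cont Q).
have cg : continuous g by rewrite /g; cont.
have ch : continuous h by rewrite /h; cont.
have pg : periodic g 1 by apply: periodicB; [exact: slice_v2_periodic S|exact: slice_v2_periodic Q].
have ph : periodic h 1 by apply: periodicB; [exact: slice_w_periodic S|exact: slice_w_periodic Q].
have g0 x : `|x| < e -> g x = 0 by move=> /v2eq; rewrite /g => ->; rewrite subrr.
have h0 : fcos h 0 = 0 by rewrite fcosB// (slice_w0 S) (slice_w0 Q) subrr.
have hc n : (0 < n)%N -> fcos h n = - fsin g n.
  by move=> n0; rewrite fcosB// fsinB// (slice_w_cos S)// (slice_w_cos Q)// opprB opprK addrC.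
have hs n : (0 < n)%N -> fsin h n = fcos g n.
  by move=> n0; rewrite fcosB// fsinB// (slice_w_sin S)// (slice_w_sin Q).
(* Up to sign the Hilbert transform swaps cosine and sine coefficients, so the bound for [g] carries
   over. *)
have hK M : \sum_(n < M) (`|fcos h n| + `|fsin h n|) <= K + L.
  apply: le_trans (fourier_sum_le cv2 cz2 (slice_v2_sum S) (slice_v2_sum Q) M).
  apply: ler_sum => -[[|n] nM] _ /=; first by rewrite h0 !fsin0 normr0 addr0 addr_ge0.
  by rewrite hc// hs// normrN addrC.
have df1c := is_derive_continuous df2.
have [cu1 cu2] := conj (slice_cont S) (slice_cont Q).
have [cv1 cz1] := conj (is_derive_continuous (slice_d2 S)) (is_derive_continuous (slice_d2 Q)).
have cdt : continuous (fun x => dt T u1 0 x - dt T u2 0 x).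
  rewrite (_ : (fun _ => _) = (fun x => (w x - f1 (u1 0 x) * v1 x) - (y x - f1 (u2 0 x) * z1 x))).
    by cont.
  by apply/funext => x; rewrite (slice_dt S) (slice_dt Q).
have g00 : forall x, g x = 0.
  apply: (unique_continuation e0 e2 cg pg g0 (fourier_series_ucv ch ph hK) h0 hc hs).
  move=> k m m0 [r r0 rP]; case: (@flat_no_lower_bound _ _ cdt flat k m m0).
  (* Within distance [e] of 0 the solutions and their space derivatives agree, so the nonlinear
     terms cancel and the difference of time derivatives is exactly [h]. *)
  exists (Num.min r e); first by rewrite lt_min r0.
  move=> x; rewrite lt_min => /andP[xr xe].
  rewrite (slice_dt S) (slice_dt Q) ueq'// veq//.
  by rewrite opprB addrA subrK; exact: rP.
move=> x; apply/eqP; rewrite -subr_eq0; apply/eqP.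
transitivity (u1 0 0 - u2 0 0); last by rewrite ueq' ?subrr// normr0.
apply: (@second_derive0_periodic (fun x => u1 0 x - u2 0 x) (fun x => v1 x - z1 x) g _ _ _ g00 x 0).
- by apply: periodicB; [exact: slice_periodic S|exact: slice_periodic Q].
- by move=> z; have a := slice_d1 S z; have b := slice_d1 Q z; exact: is_deriveB.
- by move=> z; have a := slice_d2 S z; have b := slice_d2 Q z; exact: is_deriveB.
Qed.

End initial_time.

(** * Gronwall's inequality *)

Section gronwall.
Variable R : realType.

(** The mean value theorem applied to E(x) exp(-K x) uses the derivative only inside (0, T),
    together with continuity up to the endpoints. *)
Lemma gronwall_le0 (E dE : R -> R) (T K : R) :
  {within `[0, T], continuous E} ->
  (forall t : R, 0 < t < T -> is_derive t (1 : R) E (dE t)) ->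
  (forall t, 0 < t < T -> dE t <= K * E t) -> E 0 = 0 ->
  forall t, 0 <= t <= T -> E t <= 0.
Proof.
move=> cE EdE dEK E0 t /andP[]; rewrite le_eqVlt => /predU1P[<-|t0 tT]; first by rewrite E0.
pose X (x : R) := expR (- K * x).
have dX (x : R) : is_derive x (1 : R) X (X x * - K).
  have d : is_derive x (1 : R) (fun y => - K * y) (- K).
    by apply: is_derive_eq; rewrite /GRing.scale/= mulr1.
  exact: (is_derive1_comp (is_derive_expR _) d).
pose G x := E x * X x.
have dG x : x \in `]0, t[ -> is_derive x (1 : R) G ((dE x - K * E x) * X x).
  rewrite in_itv/= => /andP[x0 xt].
  have d1 : is_derive x (1 : R) E (dE x) by apply: EdE; rewrite x0 (lt_le_trans xt).
  have d2 := dX x; apply: (@is_derive_eq _ _ _ _ _ _ _ _ (is_deriveM d1 d2)).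
  by rewrite /GRing.scale/=; ring.
have cG : {within `[0, t], continuous G}.
  have cX : continuous X by exact: is_derive_continuous dX.
  have cE' : {within `[0, t], continuous E}.
    apply: continuous_subspaceW cE => x /=; rewrite !in_itv/= => /andP[-> xt].
    exact: le_trans xt tT.
  have cX' : {within `[0, t], continuous X} by exact: continuous_subspaceT.
  by move=> x; apply: cvgM; [exact: cE'|exact: cX'].
have [c] := MVT t0 dG cG; rewrite in_itv/= => /andP[c0 ct].
rewrite subr0 {2}/G E0 mul0r subr0 => Gt.
have : G t <= 0.
  rewrite Gt mulr_le0_ge0 ?(ltW t0)// mulr_le0_ge0 ?expR_ge0// subr_le0.
  by apply: dEK; rewrite c0 (lt_le_trans ct).
by rewrite /G pmulr_lle0 // expR_gt0.
Qed.

End gronwall.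

(** * The energy identity and estimate *)

Section energy.
Variable R : realType.
Implicit Types (f g v w : R -> R) (u : R -> R -> R).
Local Notation D := (@circle_dom R).

Lemma is_derive_lipschitz_on f df (A M : R) : (forall x : R, is_derive x (1 : R) f (df x)) ->
  (forall x, `|x| <= M -> `|df x| <= A) ->
  forall x y, `|x| <= M -> `|y| <= M -> `|f x - f y| <= A * `|x - y|.
Proof.
move=> fdf dfA; suff H x y : x <= y -> `|x| <= M -> `|y| <= M -> `|f x - f y| <= A * `|x - y|.
  move=> x y xM yM; have [xy|/ltW yx] := leP x y; first exact: H.
  by rewrite distrC (distrC x); exact: H.
move=> xy xM yM; have [|c] := @MVT_segment R f df x y xy (fun z _ => fdf z).
  exact/continuous_subspaceT/(is_derive_continuous fdf).
rewrite in_itv/= => /andP[xc cy]; rewrite distrC => ->.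
rewrite (distrC x) normrM ler_wpM2r// dfA//.
by move: xM yM; rewrite !ler_norml; lra.
Qed.

(** [h] stands for the Hilbert transform of the second derivative of [g]. Against each partial sum
    of [g] the frequencies contribute a n^2 b - b n^2 a = 0, and the partial sums converge
    uniformly. *)
Lemma hilbert_dispersion_skew g h K : continuous g -> periodic g 1 -> continuous h ->
  (forall M, \sum_(n < M) (`|fcos g n| + `|fsin g n|) <= K) ->
  fcos h 0 = 0 ->
  (forall n, (0 < n)%N -> fcos h n = (2 * pi * n%:R) ^+ 2 * fsin g n) ->
  (forall n, (0 < n)%N -> fsin h n = - (2 * pi * n%:R) ^+ 2 * fcos g n) ->
  cint (fun x => g x * h x) = 0.
Proof.
move=> cg pg ch gK h0 hc hs; apply/eqP; rewrite -normr_le0; apply/ler_addgt0Pr => e e0.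
have [N /(_ N (leqnn N))] :=
  ucv_cint (@trig_sum_continuous _ _ _) ch (fourier_series_ucv cg pg gK) e0.
rewrite cint_trig_sum// big1 ?subr0 ?add0r// => -[[|n] nN] _ /=.
  by rewrite h0 !fsin0; ring.
by rewrite hc// hs//; ring.
Qed.

Lemma energy_estimate (T : R) f1 f2 u1 u2 t v1 v2 w z1 z2 y (K L A M : R) :
  (forall x : R, is_derive x (1 : R) f1 (f2 x)) -> continuous f2 ->
  solution_slice T f1 u1 t v1 v2 w K -> solution_slice T f1 u2 t z1 z2 y L ->
  (forall x, `|x| <= M -> `|f2 x| <= A) ->
  (forall x, `|u1 t x| <= M) -> (forall x, `|u2 t x| <= M) ->
  (forall x, `|v1 x| <= M) -> (forall x, `|z1 x| <= M) ->
  2 * cint (fun x => (u1 t x - u2 t x) * (dt T u1 t x - dt T u2 t x)) <=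
  3 * A * M * cint (fun x => (u1 t x - u2 t x) ^+ 2).
Proof.
move=> df1 cf2 S Q f2A u1M u2M v1M z1M; have cf1 := is_derive_continuous df1.
have [cu1 cu2] := conj (slice_cont S) (slice_cont Q).
have [cv2 cz2 cw cy] := And4 (slice_v2_cont S) (slice_v2_cont Q) (slice_w_cont S) (slice_w_cont Q).
have [cv1 cz1] := conj (is_derive_continuous (slice_d2 S)) (is_derive_continuous (slice_d2 Q)).
pose W x := u1 t x - u2 t x; pose h x := w x - y x.
have cW : continuous W by rewrite /W; cont.
have ch : continuous h by rewrite /h; cont.
have Wh : cint (fun x => W x * h x) = 0.
  apply: (@hilbert_dispersion_skew W h (K + L)) => //.
  - by apply: periodicB; [exact: slice_periodic S|exact: slice_periodic Q].
  - exact: fourier_sum_le (slice_sum S) (slice_sum Q).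
  - by rewrite fcosB// (slice_w0 S) (slice_w0 Q) subrr.
  - move=> n n0; rewrite fcosB// (slice_w_cos S)// (slice_w_cos Q)// fsinB//.
    by rewrite (slice_v2_sin S) (slice_v2_sin Q); ring.
  - move=> n n0; rewrite fsinB// (slice_w_sin S)// (slice_w_sin Q)// fcosB//.
    by rewrite (slice_v2_cos S) (slice_v2_cos Q); ring.
(* Integration by parts: the derivative of this periodic function has mean 0 and removes the term
   with [v1] - [z1], which the size of [W] does not control. *)
pose F x := W x * W x * f1 (u1 t x).
pose dF x := 2 * W x * (v1 x - z1 x) * f1 (u1 t x) + W x ^+ 2 * (f2 (u1 t x) * v1 x).
have cdF : continuous dF by rewrite /dF; cont.
have IF : cint dF = 0.
  apply: (@cint_derive_periodic _ F) => // x.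
    by rewrite /F /W (slice_periodic S) (slice_periodic Q).
  have a := slice_d1 S x; have b := slice_d1 Q x.
  have dW : is_derive x (1 : R) W (v1 x - z1 x) by exact: is_deriveB.
  have df := is_derive_compR (df1 (u1 t x)) a.
  have dW2 := is_deriveM dW dW.
  apply: (@is_derive_eq _ _ _ _ _ _ _ _ (is_deriveM dW2 df)).
  rewrite /GRing.scale/= /dF (_ : (W * W) x = W x * W x)//; ring.
(* What remains is quadratic in [W]: the first term is at most A M W^2, the second at most 2 A M W^2
   by the Lipschitz bound on [f1]. *)
pose r x := W x ^+ 2 * (f2 (u1 t x) * v1 x) - 2 * W x * (f1 (u1 t x) - f1 (u2 t x)) * z1 x.
have cr : continuous r by rewrite /r; cont.
have -> : 2 * cint (fun x => W x * (dt T u1 t x - dt T u2 t x)) = cint r.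
  transitivity (cint (fun x => 2 * (W x * h x) - dF x + r x)); last first.
    rewrite cintD; [|by cont|by cont].
    rewrite cintB; [|by cont|by cont].
    by rewrite cintZ ?Wh ?IF; [lra|cont].
  rewrite -cintZ; last first.
    under eq_fun do rewrite (slice_dt S) (slice_dt Q); by cont.
  by apply: eq_cint => x; rewrite (slice_dt S) (slice_dt Q) /dF /r /h /W; ring.
rewrite -/(W _) -cintZ; last by cont.
apply: le_cint => //; first by cont.
move=> x _; rewrite -/(W x).
have W2 := sqr_ge0 (W x); have M0 : 0 <= M by apply: le_trans (u1M 0).
have A0 : 0 <= A by apply: le_trans (f2A _ (u1M 0)).
have p1 : `|f2 (u1 t x) * v1 x| <= A * M by rewrite normrM ler_pM// f2A.
have p2 : `|W x * (f1 (u1 t x) - f1 (u2 t x)) * z1 x| <= A * M * W x ^+ 2.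
  rewrite !normrM -(@real_normK _ (W x)) ?num_real//.
  have := is_derive_lipschitz_on df1 f2A (u1M x) (u2M x); rewrite -/(W x) => p.
  rewrite (_ : A * M * `|W x| ^+ 2 = `|W x| * (A * `|W x|) * M); last by ring.
  by rewrite ler_pM ?mulr_ge0// ler_wpM2l.
have p3 : W x ^+ 2 * (f2 (u1 t x) * v1 x) <= W x ^+ 2 * (A * M).
  by rewrite ler_wpM2l//; apply: le_trans (ler_norm _) p1.
move: p2 p3; rewrite /r ler_norml => /andP[]; lra.
Qed.

(** Writing W(t + h) = W + h q, the error in the expansion of the square is h (2 W (q - Z) + h q^2),
    small relative to h uniformly in x. *)
Lemma energy_derive (T s : R) f f1 u1 u2 t : 5 / 2 < s ->
  (forall x : R, is_derive x (1 : R) f (f1 x)) -> continuous f1 ->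
  gBO_solution T s f u1 -> gBO_solution T s f u2 -> 0 < t < T ->
  is_derive t (1 : R) (fun a => cint (fun x => (u1 a x - u2 a x) ^+ 2))
    (2 * cint (fun x => (u1 t x - u2 t x) * (dt T u1 t x - dt T u2 t x))).
Proof.
move=> s52 df cf1 sol1 sol2 tI; have /andP[t0 tT] := tI.
have tI' : `[0, T]%classic t by rewrite /= in_itv/= !ltW.
have [v1 [v2 [w [K S]]]] := solution_sliceP s52 df sol1 tI'.
have [z1 [z2 [y [L Q]]]] := solution_sliceP s52 df sol2 tI'.
have [cu1 cu2] := conj (slice_cont S) (slice_cont Q).
have [cw cy] := conj (slice_w_cont S) (slice_w_cont Q).
have [cv1 cz1] := conj (is_derive_continuous (slice_d2 S)) (is_derive_continuous (slice_d2 Q)).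
pose W a x := u1 a x - u2 a x; pose Z x := dt T u1 t x - dt T u2 t x.
have cZ : continuous Z.
  rewrite (_ : Z = (fun x => (w x - f1 (u1 t x) * v1 x) - (y x - f1 (u2 t x) * z1 x))).
    by cont.
  by apply/funext => x; rewrite /Z (slice_dt S) (slice_dt Q).
have cW : continuous (W t) by rewrite /W; cont.
have [B B0 ZB] := circle_bounded cZ; have [Wm W0 WW] := circle_bounded cW.
apply/is_derive_eps => e e0.
(* The bound 1 gives |q| <= B + 2; the other bound gives |2 W (q - Z)| <= 4 Wm e' <= e / 2. *)
pose e' := Num.min 1 (e / (8 * (Wm + 1))).
have e'0 : 0 < e' by rewrite lt_min ltr01 divr_gt0//; lra.
have e'1 : e' <= 1 by rewrite ge_min lexx.
have e'W : 4 * Wm * e' <= e / 2.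
  have : e' <= e / (8 * (Wm + 1)) by rewrite ge_min lexx orbT.
  by rewrite ler_pdivlMr; [nra|lra].
have nI : \forall h \near (0 : R)^', `[0, T]%classic (t + h).
  have m0 : 0 < Num.min t (T - t) by rewrite lt_min t0 subr_gt0.
  have : \forall h \near (0 : R)^', `|h| < Num.min t (T - t) by exact: dnbhs0_lt.
  apply: filterS => h; rewrite lt_min !ltr_norml /= in_itv/=.
  by move=> /andP[/andP[? ?] /andP[? ?]]; apply/andP; split; lra.
have n1 := uniform_time_derivative s52 sol1 tI e'0.
have n2 := uniform_time_derivative s52 sol2 tI e'0.
have : \forall h \near (0 : R)^', [/\ `[0, T]%classic (t + h),
    forall x, `|h^-1 * (u1 (t + h) x - u1 t x) - dt T u1 t x| <= e' &
    forall x, `|h^-1 * (u2 (t + h) x - u2 t x) - dt T u2 t x| <= e'].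
  by move: nI n1 n2; apply: filterS3 => h.
rewrite near_withinE => /nbhs_ballP[d /= d0 dP].
pose b := e / 2 / (B + 2) ^+ 2.
have B2 : 0 < (B + 2) ^+ 2 by rewrite exprn_gt0//; lra.
have b0 : 0 < b by rewrite !divr_gt0.
exists (Num.min d b); first by rewrite lt_min d0.
move=> h; rewrite lt_min => /andP[hd hb].
have [->|h0] := eqVneq h 0; first by rewrite addr0 subrr mul0r subr0 normr0 mulr0.
have [|hI q1 q2] := dP h _ h0.
  by rewrite /ball/= sub0r normrN.
have [cuh1 cuh2] : continuous (u1 (t + h)) /\ continuous (u2 (t + h)).
  by case: sol1 => _ _ c _; case: sol2 => _ _ c' _; split; [exact: c|exact: c'].
have cWh : continuous (W (t + h)) by rewrite /W; cont.
rewrite -/(W _ _) -/(Z _) (_ : _ - _ - _ =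
  cint (fun x => W (t + h) x ^+ 2 - W t x ^+ 2 - h * (2 * (W t x * Z x)))); last first.
  rewrite -cintZ; last by cont.
  rewrite -cintZ; last by cont.
  rewrite -cintB; [|by cont|by cont].
  by rewrite -cintB; [|by cont|by cont].
apply: cint_norm_le => [|x Dx]; first by cont.
pose q := h^-1 * (W (t + h) x - W t x).
have -> : W (t + h) x = W t x + h * q by rewrite /q mulVKf//; ring.
have qZ : `|q - Z x| <= 2 * e'.
  rewrite (_ : q - Z x = (h^-1 * (u1 (t + h) x - u1 t x) - dt T u1 t x) -
     (h^-1 * (u2 (t + h) x - u2 t x) - dt T u2 t x)); last by rewrite /q /Z /W; ring.
  by apply: le_trans (ler_normB _ _) _; have := q1 x; have := q2 x; lra.
have qB : `|q| <= B + 2.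
  have := ler_normD (q - Z x) (Z x); rewrite subrK; have := ZB x Dx; lra.
rewrite (_ : _ - _ - _ = (2 * (W t x * (q - Z x)) + h * q ^+ 2) * h); last by ring.
rewrite normrM ler_wpM2r//; apply: le_trans (ler_normD _ _) _.
have r1 : `|2 * (W t x * (q - Z x))| <= e / 2.
  rewrite !normrM (ger0_norm (_ : 0 <= 2))//.
  have : `|W t x| * `|q - Z x| <= Wm * (2 * e') by rewrite ler_pM// WW.
  lra.
have r2 : `|h * q ^+ 2| <= e / 2.
  rewrite normrM normrX (_ : e / 2 = b * (B + 2) ^+ 2); last by rewrite /b divfK// gt_eqF.
  rewrite ler_pM// ?exprn_ge0//; first exact: ltW.
  by rewrite lerXn2r// nnegrE//; lra.
lra.
Qed.

End energy.

(** * Uniform bounds on [0, T] and uniqueness from equal initial data *)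

Section uniqueness_in_time.
Variable R : realType.
Implicit Types (f g v : R -> R) (u : R -> R -> R).
Local Notation D := (@circle_dom R).

Lemma sobolev_C1_bound (s : R) : 5 / 2 < s -> exists2 C, 0 < C &
  forall g (d : R), 0 < d -> continuous g -> periodic g 1 -> (sobolev_norm s g < d%:E)%E ->
    exists g1, [/\ forall x : R, is_derive x (1 : R) g (g1 x),
      forall x, `|g x| <= C * d & forall x, `|g1 x| <= C * d].
Proof.
move=> s52; have [C C0 CP] := sobolev_weighted_l1 s52.
have pi0 := @pi_gt0 R; have pC : 0 < pi * C by apply: mulr_gt0.
exists (2 * C + 4 * (pi * C)); first by lra.
move=> g d d0 cg pg gd; have [g1 [g2 [dg1 _ _ _ [_ _ b0 b1 _]]]] := fourier_C2 cg pg (CP _ _ d0 gd).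
have p1 : 0 < C * d by apply: mulr_gt0.
have p2 : 0 < pi * (C * d) by apply: mulr_gt0.
by exists g1; split => // x; [have := b0 x|have := b1 x]; lra.
Qed.

Definition C1_bounded u (t M : R) := exists v,
  [/\ forall x : R, is_derive x (1 : R) (u t) (v x), forall x, `|u t x| <= M & forall x, `|v x| <= M].

(** Near each [t0] the distance to [u t0] in H^s is below 1, which bounds the C^1 norm locally;
    compactness of [0, T] gives one bound for all times. *)
Lemma solution_C1_bounded (T s : R) f u : 5 / 2 < s -> gBO_solution T s f u ->
  exists M, forall t, 0 <= t <= T -> C1_bounded u t M.
Proof.
move=> s52 [Cu _ cu _]; have [C C0 CP] := sobolev_C1_bound s52.
pose A : set R := `[0, T]%classic.
have per a : A a -> periodic (u a) 1 by move=> /Cu[[[]]].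
have cA : compact A by exact: segment_compact.
have /compact_near_coveringP/(_ R +oo%R (fun M t => A t -> C1_bounded u t M) _) := cA.
move=> /(_ _)/filter_ex[].
  move=> t0 At0; have [us ut] := Cu t0 At0.
  have [d d0 dP] := sobolev_finite us.
  have [g1 [dg1 b0 b1]] := CP _ _ d0 (cu t0 At0) (per t0 At0) dP.
  have near1 : \forall t \near t0, A t -> (sobolev_norm s (u t \- u t0)%R < 1%:E)%E.
    have H : \forall t \near within A (nbhs t0), (sobolev_norm s (u t \- u t0)%R < 1%:E)%E.
      exact: (ereal_cvg0_lt ltr01 ut).
    by rewrite near_withinE in H.
  exists ([set t | A t -> (sobolev_norm s (u t \- u t0)%R < 1%:E)%E], [set M | C * d + C * 1 <= M]).
    by split => //=; apply: nbhs_pinfty_ge; exact: num_real.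
  move=> [t M] /= [H MM] At.
  have cd : continuous (u t \- u t0)%R.
    by have := cu t At; have := cu t0 At0 => c1 c2; rewrite /GRing.sub_fun; cont.
  have pd : periodic (u t \- u t0)%R 1 by exact: periodicB (per t At) (per t0 At0).
  have [h1 [dh1 e0 e1]] := CP _ _ ltr01 cd pd (H At).
  exists (fun x => h1 x + g1 x); split.
  - move=> x; have a := dh1 x; have b := dg1 x.
    have -> : u t = (u t \- u t0)%R \+ u t0 by apply/funext => y /=; rewrite subrK.
    exact: is_deriveD.
  - move=> x; have := ler_normD (u t x - u t0 x) (u t0 x); rewrite subrK.
    by have := b0 x; have := e0 x => /=; lra.
  - by move=> x; have := ler_normD (h1 x) (g1 x); have := b1 x; have := e1 x; lra.
by move=> M MP; exists M => t tI; apply: (MP t); rewrite /A /= in_itv.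
Qed.

Lemma energy_continuous (T s : R) f u1 u2 : 5 / 2 < s ->
  gBO_solution T s f u1 -> gBO_solution T s f u2 ->
  {within `[0, T], continuous (fun t => cint (fun x => (u1 t x - u2 t x) ^+ 2))}.
Proof.
move=> s52 sol1 sol2.
have [M1 M1P] := solution_C1_bounded s52 sol1.
have [M2 M2P] := solution_C1_bounded s52 sol2.
have [C C0 CP] := sobolev_C1_bound s52.
have near_u u (t0 e : R) : gBO_solution T s f u -> `[0, T]%classic t0 -> 0 < e ->
    \forall t \near within `[0, T] (nbhs t0), forall x, `|u t x - u t0 x| <= e.
  move=> [Cu _ cu _] t0I e0; have [_ ut] := Cu t0 t0I.
  have per a : `[0, T]%classic a -> periodic (u a) 1 by move=> /Cu[[[]]].
  have d0 : 0 < e / C by apply: divr_gt0.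
  have near1 : \forall t \near within `[0, T] (nbhs t0), (sobolev_norm s (u t \- u t0)%R < (e / C)%:E)%E.
    exact: (ereal_cvg0_lt d0 ut).
  move: near1; rewrite !near_withinE; apply: filterS => t H tI x.
  have cd : continuous (u t \- u t0)%R.
    by have := cu t tI; have := cu t0 t0I => c1 c2; rewrite /GRing.sub_fun; cont.
  have pd : periodic (u t \- u t0)%R 1 by exact: periodicB (per t tI) (per t0 t0I).
  have [g1 [_ b _]] := CP _ _ d0 cd pd (H tI).
  by have := b x; rewrite mulrC divfK// gt_eqF.
apply/subspace_continuousP => t0 t0I; apply/cvgrPdist_le => e e0.
pose M := `|M1| + `|M2| + 1.
have m1 := ler_norm M1; have m2 := ler_norm M2.
have M0 : 0 < M by rewrite /M; have := normr_ge0 M1; have := normr_ge0 M2; lra.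
pose d := e / (4 * M); have d0 : 0 < d by apply: divr_gt0 => //; lra.
have n1 := near_u u1 t0 d sol1 t0I d0.
have n2 := near_u u2 t0 d sol2 t0I d0.
have nI : \forall t \near within `[0, T] (nbhs t0), `[0, T]%classic t.
  exact: withinT.
move: nI n1 n2; apply: filterS3 => t tI p1 p2.
have cW a : `[0, T]%classic a -> continuous (fun x => (u1 a x - u2 a x) ^+ 2).
  move=> aI; case: sol1 => _ _ /(_ a aI) c1 _; case: sol2 => _ _ /(_ a aI) c2 _; by cont.
have bW a x : `[0, T]%classic a -> `|u1 a x - u2 a x| <= M.
  rewrite /= in_itv/= => aI; have [_ [_ /(_ x) b1 _]] := M1P a aI.
  have [_ [_ /(_ x) b2 _]] := M2P a aI.
  by have := ler_normB (u1 a x) (u2 a x); rewrite /M; lra.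
rewrite -cintB; [|exact: cW|exact: cW].
apply: cint_norm_le => [|x _].
  have := cW t tI; have := cW t0 t0I => c1 c2; by apply: contD => //; apply: contN.
rewrite subr_sqr normrM (_ : e = (2 * d) * (2 * M)); last by rewrite /d; field; rewrite gt_eqF.
rewrite ler_pM//.
  have := p1 x; have := p2 x; rewrite !ler_norml; lra.
by apply: le_trans (ler_normD _ _) _; have := bW t x tI; have := bW t0 x t0I; lra.
Qed.

Lemma solution_unique (T s : R) f u1 u2 : 5 / 2 < s -> smooth f ->
  gBO_solution T s f u1 -> gBO_solution T s f u2 ->
  (forall x, u1 0 x = u2 0 x) ->
  forall t, 0 <= t <= T -> forall x, u1 t x = u2 t x.
Proof.
move=> s52 sf sol1 sol2 ueq t tI.
have [f1 [f2 [df1 df2 cf2]]] := smooth_C2 sf.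
have cf1 := is_derive_continuous df2.
have [M1 M1P] := solution_C1_bounded s52 sol1.
have [M2 M2P] := solution_C1_bounded s52 sol2.
pose M := `|M1| + `|M2|.
have M1M : M1 <= M by apply: le_trans (ler_norm _) _; rewrite lerDl.
have M2M : M2 <= M by apply: le_trans (ler_norm _) _; rewrite lerDr.
have [A A0 f2A] : exists2 A, 0 <= A & forall x, `|x| <= M -> `|f2 x| <= A.
  have MM : - M <= M by rewrite /M; have := normr_ge0 M1; have := normr_ge0 M2; lra.
  have cn : {within `[- M, M], continuous (fun x => `|f2 x|)}.
    by apply: continuous_subspaceT => x; exact: (cont_norm cf2).
  have [c _ cmax] := EVT_max MM cn.
  by exists `|f2 c| => // x; rewrite ler_norml => xM; apply: cmax; rewrite in_itv.
pose E a := cint (fun x => (u1 a x - u2 a x) ^+ 2).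
have dE a : 0 < a < T -> is_derive a (1 : R) E _ := energy_derive s52 df1 cf1 sol1 sol2.
have Et : E t <= 0.
  apply: (gronwall_le0 (K := 3 * A * M) (energy_continuous s52 sol1 sol2) dE) => //.
    move=> a aI; have aI' : 0 <= a <= T by case/andP: aI => /ltW -> /ltW.
    have aT : `[0, T]%classic a by rewrite /= in_itv.
    have [v1 [v2 [w [K S]]]] := solution_sliceP s52 df1 sol1 aT.
    have [z1 [z2 [y [L Q]]]] := solution_sliceP s52 df1 sol2 aT.
    have [v [dv b1 b2]] := M1P a aI'; have [z [dz b3 b4]] := M2P a aI'.
    apply: (energy_estimate df2 cf2 S Q f2A) => x.
    - exact: le_trans (b1 x) M1M.
    - exact: le_trans (b3 x) M2M.
    (* The derivatives from the slice and from the C^1 bound are separate witnesses, identified by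
       uniqueness of derivatives. *)
    - by rewrite (derive_unique (slice_d1 S x) (dv x)); exact: le_trans (b2 x) M1M.
    - by rewrite (derive_unique (slice_d1 Q x) (dz x)); exact: le_trans (b4 x) M2M.
  rewrite /E -[RHS](cint_cst (0 : R)); apply: eq_cint => x.
  by rewrite ueq subrr expr0n.
have tT : `[0, T]%classic t by rewrite /= in_itv.
have [c1 p1] : continuous (u1 t) /\ periodic (u1 t) 1.
  by case: sol1 => /(_ t tT)[[[p _ _] _] _] _ /(_ t tT).
have [c2 p2] : continuous (u2 t) /\ periodic (u2 t) 1.
  by case: sol2 => /(_ t tT)[[[p _ _] _] _] _ /(_ t tT).
have cW : continuous (fun x => (u1 t x - u2 t x) ^+ 2) by cont.
have E0 : E t = 0.
  apply/eqP; rewrite eq_le Et/= -[X in X <= _](cint_cst (0 : R)).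
  by apply: le_cint => //; [exact: cont_cst|move=> x _; exact: sqr_ge0].
move=> x; apply/eqP; rewrite -subr_eq0; apply/eqP; move: x.
apply: periodic_eq0 => [|x Dx]; first exact: periodicB.
apply/eqP; rewrite -sqrf_eq0; apply/eqP.
exact: (cint_eq0 cW (fun x _ => sqr_ge0 _) E0).
Qed.

End uniqueness_in_time.

Theorem theorem1p10 (R : realType) (T s : R) (f : R -> R)
    (u1 u2 : R -> R -> R) (I : set R)
    (T_gt0 : 0 < T) (s_gt : 5 / 2 < s)
    (f_smooth : smooth f) (f0 : f 0 = 0)
    (u1_sol : gBO_solution T s f u1) (u2_sol : gBO_solution T s f u2)
    (I_open : open I) (I_sub : I `<=` `[- 2^-1, 2^-1]) (I0 : I 0)
    (u12_I : forall x, I x -> u1 0 x = u2 0 x)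
    (dt_flat : forall N : nat, (0 < N)%N -> exists c : R,
       \forall r \near (0 : R)^'+,
         (\int[@lebesgue_measure R]_(x in [set x : R | (`|x| <= r)%R])
            (`|dt T u1 0 x - dt T u2 0 x| ^+ 2)%:E <= (c * r ^+ N)%:E)%E) :
  forall x t : R, 0 <= t <= T -> u1 t x = u2 t x.
Proof.
have /nbhs_ballP[d /= d0 dI] : nbhs (0 : R) I by exact: open_nbhs_nbhs.
have u0 x : u1 0 x = u2 0 x.
  apply: (initial_data_eq T_gt0 s_gt f_smooth u1_sol u2_sol d0 _ dt_flat) => {}x xd.
  by apply/u12_I/dI; rewrite /ball/= sub0r normrN.
by move=> x t tT; exact: (solution_unique s_gt f_smooth u1_sol u2_sol u0 tT).
Qed.
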